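(* Let $\zeta$ be a real random variable with $\mathbb E[\zeta]=0$, $\mathbb E[\zeta^2]=1$ and $\mathbb E[e^{t\zeta}]\le e^{\sigma^2t^2/2}$ for all $t\in\mathbb R$, for some $\sigma>0$, and let $\xi\in\mathcal S_{\mathbb C}$. Then for every integer $M\ge3$, $$\log S\widetilde\mu_N(\xi)=\sum_{m=3}^M\frac{\kappa_m(\zeta)}{m!}\,\lambda_m^N\,S\mathfrak U_m(\xi)+o(\lambda_M^N),\qquad N\to\infty,$$ where $\log$ is the principal branch of the logarithm, $\lambda_m=2^{1-m/2}$, $\kappa_m(\zeta)=\frac{d^m}{dt^m}\log\mathbb E[e^{t\zeta}]\big|_{t=0}$, $S\mathfrak U_m(\xi)=\int_0^1\xi(t)^m\,dt$, and $$S\widetilde\mu_N(\xi)=e^{-Q(\xi,\xi)/2}\prod_{k=0}^{2^N-1}\mathbb E\big[e^{\zeta\,Q(\xi,\phi_{N,k})}\big].$$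
   Context: Let $\mathbf 1$ be the constant function $1$ on $[0,1]$, $e_{0,0}=\mathbf 1_{[0,1/2)}-\mathbf 1_{[1/2,1)}$, $e_{n,k}(t)=2^{n/2}e_{0,0}(2^nt-k)$, $n\ge0$, $0\le k\le2^n-1$ (Haar basis of $L^2([0,1])$), $\alpha_n=\sqrt{1+2^{2n}}$, $n\ge-1$. For $p\ge0$, $|f|_p^2=\alpha_{-1}^{2p}|\langle f,\mathbf 1\rangle|^2+\sum_{n\ge0}\sum_{k=0}^{2^n-1}\alpha_n^{2p}|\langle f,e_{n,k}\rangle|^2$; $\mathcal S=\{f\in L^2([0,1];\mathbb R):|f|_p<\infty\ \forall p\ge0\}$ and $\mathcal S_{\mathbb C}=\mathcal S+i\mathcal S$ (elements are bounded functions). $Q(\xi,\eta)=\int_0^1\xi(t)\eta(t)\,dt$ (bilinear, no conjugation), $\phi_{N,k}=2^{N/2}\mathbf 1_{[k2^{-N},(k+1)2^{-N})}$. Interpretation: $S\widetilde\mu_N$ is the $S$-transform (pairing with Wick exponentials $\mathcal E(\xi)=\exp(\int_0^1\xi\,dW-\frac12Q(\xi,\xi))$) of the Hida distribution given by the law $\widetilde\mu_N$ of the Donsker path $W_N$, the linear interpolation at the points $k/2^N$ of $2^{-N/2}\sum_{j\le k}\zeta_j$ with $\zeta_j$ i.i.d. copies of $\zeta$; $S\mathfrak U_m$ is the $S$-transform of the time-integrated Wick power $\int_0^1{:}\dot W(t)^m{:}\,dt$. The explicit formulas above may be taken as definitions. *)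

(* Defs.v *)
From HB Require Import structures.
From mathcomp Require Import all_boot all_order all_algebra.
From mathcomp Require Import all_classical all_reals all_analysis.
From mathcomp Require Import complex.

Set Implicit Arguments.
Unset Strict Implicit.
Unset Printing Implicit Defensive.

Import Order.TTheory GRing.Theory Num.Theory.
Import numFieldNormedType.Exports.
Import ComplexField.Normc.

Local Open Scope classical_set_scope.
Local Open Scope ring_scope.
Local Open Scope complex_scope.

Definition cexp (R : realType) (z : R[i]) : R[i] :=
  (expR (complex.Re z))%:C * (cos (complex.Im z) +i* sin (complex.Im z)).

(* Values in ]- pi, pi]; the negative real axis is sent to pi. The value at
   z = 0 is irrelevant. *)
Definition carg (R : realType) (z : R[i]) : R :=
  if 0 <= complex.Im z then acos (complex.Re z / normc z)
  else - acos (complex.Re z / normc z).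

Definition clog (R : realType) (z : R[i]) : R[i] := ln (normc z) +i* carg z.

Definition cintegral d (T : measurableType d) (R : realType)
    (mu : {measure set T -> \bar R}) (D : set T) (f : T -> R[i]) : R[i] :=
  Rintegral mu D (fun x => complex.Re (f x)) +i*
  Rintegral mu D (fun x => complex.Im (f x)).

(* An element of L^2([0,1]) is represented by a function on the real line, of
   which only the restriction to [0,1], up to a.e. equality, matters. *)

Section test_functions.
Variable R : realType.
Implicit Types (f g : R -> R) (xi eta : R -> R[i]).

Definition in_L2 f : Prop :=
  f \_ `[0, 1] \in Lfun (@lebesgue_measure R) 2%:E.

Definition inner01 f g : R := Rintegral lebesgue_measure `[0, 1] (f \* g).

Definition haar00 (t : R) : R := \1_(`[0, 2^-1[) t - \1_(`[2^-1, 1[) t.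

Definition haar (n k : nat) (t : R) : R :=
  2 `^ (n%:R / 2) * haar00 (2 ^+ n * t - k%:R).

(* n : int because the index -1 is used for the constant mode. *)
Definition alpha (n : int) : R := Num.sqrt (1 + 2 ^ (2 * n)).

(* The square of the norm |f|_p, as an extended real number. *)
Definition Snorm2 (p : R) f : \bar R :=
  ((alpha (- 1) `^ (2 * p) * `|inner01 f (cst 1)| ^+ 2)%:E +
   \sum_(0 <= n <oo)
     (\sum_(0 <= k < 2 ^ n)
        alpha n%:Z `^ (2 * p) * `|inner01 f (haar n k)| ^+ 2)%R%:E)%E.

Definition in_S f : Prop :=
  in_L2 f /\ forall p : R, 0 <= p -> (Snorm2 p f < +oo)%E.

Definition in_SC xi : Prop :=
  in_S (fun t => complex.Re (xi t)) /\ in_S (fun t => complex.Im (xi t)).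

Definition Q xi eta : R[i] :=
  cintegral lebesgue_measure `[0, 1] (fun t => xi t * eta t).

Definition phi (N k : nat) (t : R) : R[i] :=
  (2 `^ (N%:R / 2) * \1_(`[k%:R / 2 ^+ N, k.+1%:R / 2 ^+ N[) t)%:C.

Definition lambda (m : nat) : R := 2 `^ (1 - m%:R / 2).

(* S-transform of the integrated Wick power, given by its explicit formula. *)
Definition SU (m : nat) xi : R[i] :=
  cintegral lebesgue_measure `[0, 1] (fun t => xi t ^+ m).

End test_functions.

Section random_variable.
Variables (d : measure_display) (T : measurableType d) (R : realType).
Variables (P : probability T R) (zeta : {RV P >-> R}).

(* E[exp(zeta z)] for complex z. *)
Definition cmgf (z : R[i]) : R[i] :=
  cintegral P setT (fun w => cexp ((zeta w)%:C * z)).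

Definition kappa (m : nat) : R :=
  derive1n m (fun t : R => ln (fine ('M_P zeta t))) 0.

(* S-transform of the law of the N-th Donsker path, given by its explicit
   formula. *)
Definition Smu (N : nat) (xi : R -> R[i]) : R[i] :=
  cexp (- Q xi xi / 2) * \prod_(0 <= k < 2 ^ N) cmgf (Q xi (@phi R N k)).

End random_variable.

(* Main.v *)
(** Write [W_N] for [- Q(xi, xi) / 2 + sum_k log E[exp(zeta a_k)]], where
    [a_k = Q(xi, phi_{N,k}) = 2^{-N/2} Z_k] and [Z_k] is the mean of [xi] over the
    [k]-th dyadic interval of level [N].

    Cumulants at complex arguments, without complex logarithms or derivatives:
    near [0], [E[exp(zeta z)] = exp(sum_{m <= M} kappa_m z^m / m! + O(z^{M+1}))].
    For real [z] this is Taylor's formula for the log moment generating function;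
    after truncation both sides are real polynomials up to [O(z^{M+1})], so their
    coefficients up to degree [M] agree, and the estimate persists for complex [z].

    Haar regularity: the mean over a dyadic interval and the mean over its parent
    of level [n] differ by [2^{n/2}] times a Haar coefficient, which decays faster
    than [2^{-nq}] for every [q]. With Lebesgue's differentiation theorem the
    dyadic means converge to [xi] a.e. at that rate, so that
    [sum_k a_k^m = lambda_m^N (S U_m(xi) + O(2^{-Nq}))].

    As [kappa_0 = kappa_1 = 0] and [kappa_2 = lambda_2 = 1], the quadratic term
    cancels [Q(xi, xi) / 2], and the remainder is [O(lambda_{M+1}^N)]. In
    particular [W_N] tends to [0], so the principal logarithm of [exp W_N] is
    [W_N] for large [N]. *)

Require Import Defs.
From HB Require Import structures.
From mathcomp Require Import all_boot all_order all_algebra.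
From mathcomp Require Import all_classical all_reals all_analysis.
From mathcomp Require Import measurable_realfun complex ring lra zify.

Set Implicit Arguments.
Unset Strict Implicit.
Unset Printing Implicit Defensive.

Import Order.TTheory GRing.Theory Num.Theory.
Import numFieldNormedType.Exports.
Import ComplexField.Normc.

Local Open Scope classical_set_scope.
Local Open Scope ring_scope.
Local Open Scope complex_scope.

(** * Mean value and Taylor estimates for real functions *)

Section real_taylor.
Variable R : realType.
Implicit Types (f g : R -> R) (x y : R).

Lemma is_derive_fsum (I : Type) (s : seq I) (h : I -> R -> R) (dh : I -> R) x :
  (forall i, is_derive x 1 (h i) (dh i)) ->
  is_derive x 1 (fun y => \sum_(i <- s) h i y) (\sum_(i <- s) dh i).
Proof.
move=> hd; elim: s => [|i s IHs].
  rewrite big_nil; under eq_fun do rewrite big_nil.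
  exact: is_derive_cst.
rewrite big_cons; under eq_fun do rewrite big_cons.
exact: is_deriveD.
Qed.

Lemma is_derive_mul f g x df dg : is_derive x 1 f df -> is_derive x 1 g dg ->
  is_derive x 1 (fun y => f y * g y) (df * g x + f x * dg).
Proof.
move=> fd gd; have := is_deriveM fd gd.
by rewrite /GRing.scale/= [g x * df]mulrC addrC.
Qed.

Lemma is_derive_scale (c x : R) f df : is_derive x 1 f df ->
  is_derive x 1 (fun y => c * f y) (c * df).
Proof. by move=> fd; exact: (is_deriveZ c fd). Qed.

Lemma is_derive_monomial (k : nat) (c x : R) :
  is_derive x 1 (fun y => c * y ^+ k.+1 / k.+1`!%:R) (c * x ^+ k / k`!%:R).
Proof.
have -> : (fun y => c * y ^+ k.+1 / k.+1`!%:R) =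
          (fun y => (c / k.+1`!%:R) * (id ^+ k.+1 : R -> R) y).
  by apply/funext => y; rewrite exprfctE mulrAC.
have -> : c * x ^+ k / k`!%:R = (c / k.+1`!%:R) * (k.+1%:R * x ^+ k *: 1).
  rewrite factS natrM /GRing.scale/= mulr1.
  have : k`!%:R != 0 :> R by rewrite pnatr_eq0 -lt0n fact_gt0.
  have : k.+1%:R != 0 :> R by rewrite pnatr_eq0.
  by move: (k.+1%:R : R) (k`!%:R : R) => u v u0 v0; field; rewrite u0 v0.
exact: is_derive_scale.
Qed.

Lemma is_derive_continuous f df x : is_derive x 1 f df -> {for x, continuous f}.
Proof.
by move=> fd; apply/differentiable_continuous/derivable1_diffP; case: fd.
Qed.

Lemma MVT0_bound f (df : R -> R) (B x : R) :
  (forall y, is_derive y 1 f (df y)) -> f 0 = 0 ->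
  (forall y, `|y| <= `|x| -> `|df y| <= B) -> `|f x| <= B * `|x|.
Proof.
move=> fd f0 dfB.
have cf a b : {within `[a, b], continuous f}.
  by apply: continuous_subspaceT => y; apply: is_derive_continuous.
have [x0|x0] := leP 0 x.
  have [c] := MVT_segment x0 (fun y _ => fd y) (cf _ _).
  rewrite in_itv/= => /andP[c0 cx]; rewrite f0 !subr0 => ->.
  by rewrite normrM ler_wpM2r// dfB// !ger0_norm// (le_trans c0).
have [c] := MVT_segment (ltW x0) (fun y _ => fd y) (cf _ _).
rewrite in_itv/= => /andP[cx c0]; rewrite f0 !sub0r => /eqP.
rewrite eqr_oppLR mulrN opprK => /eqP ->.
by rewrite normrM ler_wpM2r// dfB// !ler0_norm// ?lerN2// ltW.
Qed.

(** The successive derivatives are supplied as a family [F], so closed forms can be used directly.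
    By induction: the remainder of [F 0] vanishes at 0 and its derivative is the remainder of [F 1],
    so the mean value theorem gains one power of [|x|]. The factor [1/n!] is given up. *)
Lemma taylor_bound (n : nat) (F : nat -> R -> R) (r C : R) :
  (forall k x, (k < n)%N -> is_derive x 1 (F k) (F k.+1 x)) ->
  (forall x, `|x| <= r -> `|F n x| <= C) ->
  forall x, `|x| <= r ->
    `|F 0 x - \sum_(0 <= k < n) F k 0 * x ^+ k / k`!%:R| <= C * `|x| ^+ n.
Proof.
elim: n F => [|n IHn] F Fd FC x xr.
  by rewrite big_geq// subr0 expr0 mulr1 FC.
have H (y : R) : `|y| <= r ->
    `|F 1 y - \sum_(0 <= k < n) F k.+1 0 * y ^+ k / k`!%:R| <= C * `|y| ^+ n.
  apply: (IHn (fun k => F k.+1)) => // k z kn.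
  exact: Fd.
rewrite exprSr mulrA.
have C0 : 0 <= C by apply: le_trans (FC _ xr).
apply: (@MVT0_bound (fun x => F 0 x - \sum_(0 <= k < n.+1) F k 0 * x ^+ k / k`!%:R)
  (fun y => F 1 y - \sum_(0 <= k < n) F k.+1 0 * y ^+ k / k`!%:R)).
- move=> y; apply: is_deriveB; first exact: Fd.
  under eq_fun do rewrite big_nat_recl//= expr0.
  rewrite -[X in is_derive _ _ _ X]add0r.
  apply: is_deriveD.
  by apply: is_derive_fsum => k; exact: is_derive_monomial.
- rewrite big_nat_recl//= expr0 mulr1 fact0 divr1 big1 ?addr0 ?subrr// => k _.
  by rewrite expr0n/= mulr0 mul0r.
- move=> y yx; apply: le_trans (H _ (le_trans yx xr)) _.
  by rewrite ler_wpM2l// lerXn2r ?nnegrE.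
Qed.

(** A quadratic bound on the first-order remainder makes the difference quotient converge at speed
    [C * |h|]. This allows differentiation under the expectation without a limit theorem for
    integrals. *)
Lemma is_derive_quadratic (f : R -> R) (t l C : R) :
  (forall h, `|h| <= 1 -> `|f (t + h) - f t - h * l| <= C * h ^+ 2) ->
  is_derive t 1 f l.
Proof.
move=> fC.
have C0 : 0 <= C.
  by have := fC 1; rewrite normr1 lexx expr1n mulr1 => /(_ isT); apply: le_trans.
suff H : (fun h => h^-1 *: (f (h *: (1 : R) + t) - f t)) @ 0^' --> l.
  apply: DeriveDef; first by apply/cvg_ex; exists l.
  exact/cvg_lim.
apply/cvgrPdist_le => e e0.
near=> h.
have h0 : h != 0 by near: h; exact: nbhs_dnbhs_neq.
have h1 : `|h| <= 1 by near: h; apply: dnbhs0_le.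
have hC : `|h| <= e / (C + 1) by near: h; apply: dnbhs0_le; rewrite divr_gt0// ltr_wpDl.
have -> : l - h^-1 *: (f (h *: (1 : R) + t) - f t) =
    - (h^-1 * (f (t + h) - f t - h * l)).
  by rewrite /GRing.scale/= mulr1 [h + t]addrC [in RHS]mulrBr mulKf// opprB.
rewrite normrN normrM normfV ler_pdivrMl ?normr_gt0//.
apply: le_trans (fC _ h1) _.
rewrite -real_normK ?num_real// expr2 mulrA mulrC ler_wpM2l//.
apply: (@le_trans _ _ ((C + 1) * `|h|)).
  by rewrite ler_wpM2r// lerDl.
by rewrite -ler_pdivlMl ?ltr_wpDl// mulrC.
Unshelve. all: by end_near. Qed.

End real_taylor.

(** * Modulus, exponential and logarithm on the complex numbers *)

Section complex_elementary.
Variable R : realType.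
Implicit Types (z w : R[i]) (x y : R).

Lemma normcE_sqrt z : normc z = Num.sqrt (complex.Re z ^+ 2 + complex.Im z ^+ 2).
Proof. by case: z. Qed.

Lemma normc_ge0 z : 0 <= normc z.
Proof. by rewrite normcE_sqrt sqrtr_ge0. Qed.

Lemma norm_normc z : `|z| = (normc z)%:C.
Proof. by rewrite normc_def normcE_sqrt. Qed.

Lemma normcR x : normc x%:C = `|x|.
Proof. by rewrite normcE_sqrt /= expr0n addr0 sqrtr_sqr. Qed.

Lemma normcX z n : normc (z ^+ n) = normc z ^+ n.
Proof.
elim: n => [|n IHn]; first by rewrite !expr0 normc1.
by rewrite !exprS normcM IHn.
Qed.

Lemma normc_Re z : `|complex.Re z| <= normc z.
Proof.
rewrite normcE_sqrt -sqrtr_sqr ler_wsqrtr// lerDl sqr_ge0//.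
Qed.

Lemma normc_Im z : `|complex.Im z| <= normc z.
Proof.
rewrite normcE_sqrt -sqrtr_sqr ler_wsqrtr// lerDr sqr_ge0//.
Qed.

Lemma normc_le_ReIm z : normc z <= `|complex.Re z| + `|complex.Im z|.
Proof.
have -> : z = (complex.Re z)%:C + (0 +i* complex.Im z).
  by case: z => a b; apply/eqP; rewrite eq_complex /= addr0 add0r !eqxx.
apply: le_trans (le_normcD _ _) _.
rewrite normcR normcE_sqrt /= expr0n add0r sqrtr_sqr.
by rewrite /= !add0r !addr0.
Qed.

Lemma normcB z w : normc (z - w) <= normc z + normc w.
Proof. by rewrite -(normcN w) le_normcD. Qed.

Lemma normc_sum (I : Type) (s : seq I) (F : I -> R[i]) :
  normc (\sum_(i <- s) F i) <= \sum_(i <- s) normc (F i).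
Proof.
elim: s => [|i s IHs]; first by rewrite !big_nil normc0.
by rewrite !big_cons (le_trans (le_normcD _ _))// lerD2l.
Qed.

Lemma ReD z w : complex.Re (z + w) = complex.Re z + complex.Re w.
Proof. by case: z w => ? ? []. Qed.

Lemma ImD z w : complex.Im (z + w) = complex.Im z + complex.Im w.
Proof. by case: z w => ? ? []. Qed.

Lemma ReN z : complex.Re (- z) = - complex.Re z.
Proof. by case: z. Qed.

Lemma ImN z : complex.Im (- z) = - complex.Im z.
Proof. by case: z. Qed.

Lemma ReM z w : complex.Re (z * w) =
  complex.Re z * complex.Re w - complex.Im z * complex.Im w.
Proof. by case: z w => ? ? []. Qed.

Lemma ImM z w : complex.Im (z * w) =
  complex.Re z * complex.Im w + complex.Im z * complex.Re w.
Proof. by case: z w => ? ? []. Qed.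

Lemma ReMr x z : complex.Re (x%:C * z) = x * complex.Re z.
Proof. by rewrite ReM /= mul0r subr0. Qed.

Lemma ImMr x z : complex.Im (x%:C * z) = x * complex.Im z.
Proof. by rewrite ImM /= mul0r addr0. Qed.

Lemma Re_sum (I : Type) (s : seq I) (F : I -> R[i]) :
  complex.Re (\sum_(i <- s) F i) = \sum_(i <- s) complex.Re (F i).
Proof.
by elim: s => [|i s IHs]; rewrite ?big_nil// !big_cons ReD IHs.
Qed.

Lemma Im_sum (I : Type) (s : seq I) (F : I -> R[i]) :
  complex.Im (\sum_(i <- s) F i) = \sum_(i <- s) complex.Im (F i).
Proof.
by elim: s => [|i s IHs]; rewrite ?big_nil// !big_cons ImD IHs.
Qed.

Lemma complex_ext z w :
  complex.Re z = complex.Re w -> complex.Im z = complex.Im w -> z = w.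
Proof. by case: z w => ? ? [? ?] /= -> ->. Qed.

Lemma Re_cexp z : complex.Re (cexp z) = expR (complex.Re z) * cos (complex.Im z).
Proof. by rewrite /cexp ReMr. Qed.

Lemma Im_cexp z : complex.Im (cexp z) = expR (complex.Re z) * sin (complex.Im z).
Proof. by rewrite /cexp ImMr. Qed.

Lemma cexp0 : cexp 0 = 1 :> R[i].
Proof.
by apply: complex_ext; rewrite ?Re_cexp ?Im_cexp /= expR0 ?cos0 ?sin0 mul1r.
Qed.

Lemma cexpD z w : cexp (z + w) = cexp z * cexp w.
Proof.
apply: complex_ext.
  by rewrite (Re_cexp (z + w)) ReM !Re_cexp !Im_cexp ReD ImD expRD cosD; ring.
rewrite (Im_cexp (z + w)) ImM !Re_cexp !Im_cexp.
by rewrite ReD ImD expRD sinD; ring.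
Qed.

Lemma cexp_sum (I : Type) (s : seq I) (F : I -> R[i]) :
  cexp (\sum_(i <- s) F i) = \prod_(i <- s) cexp (F i).
Proof.
by elim: s => [|i s IHs]; rewrite ?big_nil ?cexp0// !big_cons cexpD IHs.
Qed.

Lemma normc_cexp z : normc (cexp z) = expR (complex.Re z).
Proof.
rewrite normcE_sqrt Re_cexp Im_cexp !exprMn -mulrDr cos2Dsin2 mulr1.
by rewrite sqrtr_sqr ger0_norm// expR_ge0.
Qed.

(** The bound puts the imaginary part in []-pi, pi[]. There it has the sign of its sine, which
    selects the right branch of [carg], and [acos] inverts [cos] up to that sign. *)
Lemma clog_cexp z : normc z < pi -> clog (cexp z) = z.
Proof.
move=> zpi; have : `|complex.Im z| < pi by apply: le_lt_trans (normc_Im _) zpi.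
rewrite ltr_norml => /andP[Npi bpi].
rewrite /clog normc_cexp expRK.
apply: complex_ext => //=.
rewrite /carg normc_cexp Re_cexp Im_cexp mulrAC divff ?gt_eqF ?expR_gt0//.
rewrite mul1r pmulr_rge0 ?expR_gt0//.
have [b0|b0] := leP 0 (complex.Im z).
  by rewrite sin_ge0_pi ?b0 ?(ltW bpi)// cosK// in_itv/= b0 ltW.
have s0 : 0 < sin (- complex.Im z).
  by apply: sin_gt0_pi; rewrite oppr_gt0 b0/= ltrNl.
rewrite sinN oppr_gt0 in s0.
by rewrite leNgt s0/= -cosN cosK ?opprK// in_itv/= oppr_ge0 ltW//= lerNl ltW.
Qed.

Lemma atan_le y : `|atan y| <= `|y|.
Proof.
rewrite -[leRHS]mul1r.
apply: (@MVT0_bound R (@atan R) (fun y => (1 + y ^+ 2)^-1)); first last.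
- move=> x _; rewrite ger0_norm ?invr_ge0 ?addr_ge0 ?sqr_ge0//.
  by rewrite invf_le1 ?ltr_pwDl ?sqr_ge0// lerDl sqr_ge0.
- exact: atan0.
Qed.

(** The inequality [ln (1 + y) <= y] at [y = x - 1] and at [y = 1/x - 1] bounds [ln x] from both
    sides; [x >= 1/2] bounds [1/x] by 2. *)
Lemma ln_norm_le x : 2^-1 <= x -> `|ln x| <= 2 * `|x - 1|.
Proof.
move=> x2.
have x0 : 0 < x by lra.
have h1 : ln x <= x - 1.
  have := @le_ln1Dx R (x - 1).
  rewrite addrCA subrr addr0; apply; lra.
have h2 : - ln x <= x^-1 - 1.
  rewrite -lnV ?posrE//.
  have := @le_ln1Dx R (x^-1 - 1).
  by rewrite addrCA subrr addr0; apply; rewrite ltrBrDl subrr invr_gt0.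
have h3 : x^-1 - 1 <= 2 * `|x - 1|.
  have -> : x^-1 - 1 = x^-1 * (1 - x) by field; lra.
  apply: le_trans (ler_norm _) _.
  rewrite normrM distrC ler_wpM2r// ger0_norm ?invr_ge0 ?(ltW x0)//.
  by rewrite -[leRHS]invrK lef_pV2// posrE invr_gt0; lra.
rewrite ler_norml; apply/andP; split; first lra.
apply: le_trans h1 _; apply: le_trans (ler_norm _) _.
by rewrite ler_peMl// ler1n.
Qed.

(** A logarithm with a Lipschitz bound at 1. Since [Re z >= 1/2], the argument is
    [atan (Im z / Re z)]; the modulus and the argument each contribute at most twice the distance to
    1. *)
Lemma cexp_near1 z : normc (z - 1) <= 2^-1 ->
  exists2 w, z = cexp w & normc w <= 4 * normc (z - 1).
Proof.
move=> z1; set e := normc (z - 1) in z1 *.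
pose a := complex.Re z; pose b := complex.Im z.
have ha : `|a - 1| <= e.
  by apply: le_trans (normc_Re (z - 1)); rewrite ReD ReN.
have hb : `|b| <= e.
  by apply: le_trans (normc_Im (z - 1)); rewrite ImD ImN /= oppr0 addr0.
have a2 : 2^-1 <= a.
  move: ha; rewrite ler_norml => /andP[+ _]; lra.
have a0 : 0 < a by lra.
have n1 : normc z - 1 <= e.
  rewrite lerBlDr -{1}(subrK 1 z) (le_trans (le_normcD _ _))//.
  by rewrite normc1.
have n2 : 1 - e <= normc z.
  rewrite lerBlDl.
  have -> : 1 = normc (z - (z - 1)) :> R by rewrite opprB addrC subrK normc1.
  by rewrite [leRHS]addrC normcB.
have n0 : 0 < normc z by lra.
exists (ln (normc z) +i* atan (b / a)); last first.
  apply: le_trans (normc_le_ReIm _) _ => /=.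
  have h1 : `|ln (normc z)| <= 2 * e.
    apply: le_trans (ln_norm_le _) _; first lra.
    by rewrite ler_wpM2l// ler_norml; apply/andP; split; lra.
  have h2 : `|atan (b / a)| <= 2 * e.
    apply: le_trans (atan_le _) _.
    rewrite normrM normfV (ger0_norm (ltW a0)) mulrC ler_pM//.
      by rewrite invr_ge0 ltW.
    by rewrite -[leRHS]invrK lef_pV2// posrE; lra.
  lra.
have sq : Num.sqrt (1 + (b / a) ^+ 2) = normc z / a.
  have z2 : normc z ^+ 2 = a ^+ 2 + b ^+ 2.
    by rewrite normcE_sqrt sqr_sqrtr// addr_ge0 ?sqr_ge0.
  have -> : 1 + (b / a) ^+ 2 = (normc z / a) ^+ 2.
    by rewrite !expr_div_n z2; field; lra.
  by rewrite sqrtr_sqr ger0_norm// divr_ge0// ltW.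
apply: complex_ext; rewrite ?(Re_cexp, Im_cexp) /= lnK ?posrE//.
  by rewrite cos_atan sq invf_div mulrCA divff ?mulr1// gt_eqF.
have -> : sin (atan (b / a)) = (b / a) * cos (atan (b / a)).
  rewrite -[X in _ = X * _]atanK /tan.
  by rewrite divfK// gt_eqF// cos_atan invr_gt0 sqrtr_gt0 ltr_pwDl// sqr_ge0.
rewrite cos_atan sq invf_div -/b; field.
by rewrite !gt_eqF.
Qed.

Lemma is_derive_cexp (c w : R[i]) (s : R) :
  is_derive s 1 (fun s => complex.Re (c * cexp (s%:C * w)))
                (complex.Re (c * w * cexp (s%:C * w))).
Proof.
have -> : (fun s => complex.Re (c * cexp (s%:C * w))) =
  (fun s => expR (s * complex.Re w) *
     (complex.Re c * cos (s * complex.Im w) - complex.Im c * sin (s * complex.Im w))).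
  apply/funext => x; rewrite ReM Re_cexp Im_cexp ReMr ImMr; ring.
have dm x0 x : is_derive x0 1 (fun s : R => s * x) x.
  have := is_derive_mul (is_derive_id x0 1) (is_derive_cst x x0 1).
  by rewrite mul1r mulr0 addr0.
have de x0 x : is_derive x0 1 (fun s : R => expR (s * x)) (expR (x0 * x) * x).
  exact: (@is_derive1_comp R expR (fun s : R => s * x)).
have dc x0 x : is_derive x0 1 (fun s : R => cos (s * x)) (- sin (x0 * x) * x).
  exact: (@is_derive1_comp R cos (fun s : R => s * x)).
have ds x0 x : is_derive x0 1 (fun s : R => sin (s * x)) (cos (x0 * x) * x).
  exact: (@is_derive1_comp R sin (fun s : R => s * x)).
have := is_derive_mul (de s (complex.Re w)) (is_deriveB
  (is_derive_scale (complex.Re c) (dc s (complex.Im w)))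
  (is_derive_scale (complex.Im c) (ds s (complex.Im w)))).
move/is_derive_eq; apply.
rewrite !fctE !(ReM, ImM, Re_cexp, Im_cexp) /= !(mul0r, subr0, addr0); ring.
Qed.

(** Real Taylor estimate along the segment from 0 to [w]: the [k]-th derivative of
    [Re (c * cexp (s w))] in [s] is [Re (c * w^k * cexp (s w))]. The factor [c] allows both the real
    and the imaginary part to be extracted. *)
Lemma ReC_cexp_taylor (n : nat) (c w : R[i]) : normc c <= 1 ->
  `|complex.Re (c * (cexp w - \sum_(0 <= k < n) (k`!%:R^-1)%:C * w ^+ k))| <=
  normc w ^+ n * expR (normc w).
Proof.
move=> c1.
have bnd s : `|s| <= 1 ->
    `|complex.Re (c * w ^+ n * cexp (s%:C * w))| <= normc w ^+ n * expR (normc w).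
  move=> s1; apply: le_trans (normc_Re _) _.
  rewrite (normcM _ (cexp _)) (normcM c) normcX -[leRHS]mul1r -mulrA.
  rewrite ler_pM ?mulr_ge0 ?exprn_ge0 ?normc_ge0//.
  rewrite ler_wpM2l ?exprn_ge0 ?normc_ge0// normc_cexp ler_expR ReMr.
  apply: le_trans (ler_norm _) _; rewrite normrM -[leRHS]mul1r.
  by rewrite ler_pM// normc_Re.
have /= := @taylor_bound R n (fun k s => complex.Re (c * w ^+ k * cexp (s%:C * w)))
  1 _ _ bnd 1.
rewrite normr1 expr1n mulr1 lexx. rewrite mulr1 mul1r => H.

have -> : complex.Re (c * (cexp w - \sum_(0 <= k < n) (k`!%:R^-1)%:C * w ^+ k)) =
    complex.Re (c * cexp w) -
    \sum_(0 <= k < n) complex.Re (c * w ^+ k * cexp (0%:C * w)) * 1 ^+ k / k`!%:R.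
  rewrite mulrBr ReD ReN mulr_sumr Re_sum; congr (_ - _).
  apply: eq_bigr => k _.
  by rewrite mul0r cexp0 mulr1 expr1n mulr1 mulrCA ReMr mulrC.
apply: H => // k x _.
have := is_derive_cexp (c * w ^+ k) w x.
by rewrite -(mulrA c) -exprSr.
Qed.

Lemma cexp_taylor (n : nat) w :
  normc (cexp w - \sum_(0 <= k < n) (k`!%:R^-1)%:C * w ^+ k) <=
  2 * (normc w ^+ n * expR (normc w)).
Proof.
apply: le_trans (normc_le_ReIm _) _; rewrite mulr_natl mulr2n.
set u := _ - _; apply: lerD.
  by have := @ReC_cexp_taylor n 1 w; rewrite mul1r normc1 lexx => /(_ isT).
(* The imaginary part is the case [c = -i] of the previous estimate. *)
have -> : complex.Im u = complex.Re ((0 -i* 1) * u).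
  by rewrite ReM /=; ring.
by apply: ReC_cexp_taylor; rewrite normcE_sqrt /= expr0n add0r sqrrN expr1n sqrtr1.
Qed.

Lemma expR_taylor (n : nat) x :
  `|expR x - \sum_(0 <= k < n) x ^+ k / k`!%:R| <= expR `|x| * `|x| ^+ n.
Proof.
have := @taylor_bound R n (fun _ => expR) `|x| (expR `|x|) _ _ x (lexx _).
under eq_bigr do rewrite expR0 mul1r.
apply => y yx.
by rewrite ger0_norm ?expR_ge0// ler_expR (le_trans (ler_norm _)).
Qed.

Lemma expR_sub1_le x : `|expR x - 1| <= expR `|x| * `|x|.
Proof.
by have := expR_taylor 1 x; rewrite big_nat1 expr0 fact0 divr1 expr1.
Qed.

Lemma expR_sub_le x y : `|expR x - expR y| <= expR (`|x - y| + `|y|) * `|x - y|.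
Proof.
have -> : expR x - expR y = expR y * (expR (x - y) - 1).
  by rewrite mulrBr -expRD addrCA subrr addr0 mulr1.
rewrite normrM (expRD `|_|) [X in _ <= X * _]mulrC -mulrA ler_pM//.
  by rewrite ger0_norm ?expR_ge0// ler_expR ler_norm.
exact: expR_sub1_le.
Qed.

Lemma exprn_le_expR (n : nat) x : `|x| ^+ n <= n`!%:R * expR `|x|.
Proof.
have n0 : 0 < n`!%:R :> R by rewrite ltr0n fact_gt0.
rewrite mulrC -ler_pdivrMr//; case: n n0 => [|n] n0.
  by rewrite expr0 fact0 divr1 -expR0 ler_expR.
by apply: le_trans (expR_ge1Dxn n (normr_ge0 x)); rewrite lerDr.
Qed.

End complex_elementary.

(** * Transfer of an exponential expansion from real to complex arguments *)

Section power_series_matching.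
Variable R : realType.
Local Notation pC := (map_poly (real_complex R)).

(** Truncated series are formal polynomials with real coefficients, so that one object is evaluated
    at real points and, through [pC], at complex ones. *)
Definition psum (c : nat -> R) (n : nat) : {poly R} :=
  \sum_(0 <= k < n) c k *: 'X^k.

Lemma horner_psum c n x : (psum c n).[x] = \sum_(0 <= k < n) c k * x ^+ k.
Proof.
by rewrite horner_sum; apply: eq_bigr => k _; rewrite hornerZ hornerXn.
Qed.

Lemma horner_psumC c n z :
  (pC (psum c n)).[z] = \sum_(0 <= k < n) (c k)%:C * z ^+ k.
Proof.
rewrite rmorph_sum horner_sum; apply: eq_bigr => k _.
by rewrite /= map_polyZ map_polyXn hornerZ hornerXn.
Qed.

Lemma psumS c n : psum c n.+1 = psum (fun k => c k.+1) n * 'X + (c 0)%:P.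
Proof.
rewrite /psum big_nat_recl// expr0 alg_polyC addrC mulr_suml; congr (_ + _).
by apply: eq_bigr => k _; rewrite -scalerAl -exprSr.
Qed.

Lemma poly_bound (p : {poly R}) : exists2 B, 0 <= B &
  forall z, normc z <= 1 -> normc (pC p).[z] <= B.
Proof.
elim/poly_ind: p => [|p c [B B0 pB]].
  by exists 0 => // z _; rewrite map_poly0 horner0 normc0.
exists (B + `|c|) => [|z z1]; first by rewrite addr_ge0.
rewrite rmorphD rmorphM/= map_polyX map_polyC/= !hornerE.
rewrite (le_trans (le_normcD _ _))// normcM normcR lerD2r.
by rewrite -[leRHS]mulr1 ler_pM ?normc_ge0// pB.
Qed.

(** Induction on [n]: if [p = q * 'X^n] and [p] is [O(t^(n+1))] on the right of 0, then [q] is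
    [O(t)], so its constant term is 0 and one more factor ['X] splits off. *)
Lemma poly_divXn (p : {poly R}) (n : nat) (C r : R) : 0 < r ->
  (forall t, 0 < t <= r -> `|p.[t]| <= C * t ^+ n) -> exists q, p = q * 'X^n.
Proof.
move=> r0; elim: n C => [|n IHn] C pC'; first by exists p; rewrite expr0 mulr1.
have [|q pq] := IHn (C * r).
  move=> t /andP[t0 tr]; have H := pC' t; rewrite t0 tr exprS mulrA in H.
  apply: le_trans (H isT) _; rewrite ler_wpM2r ?exprn_ge0 ?(ltW t0)//.
  have C0 : 0 <= C.
    have := pC' t; rewrite t0 tr => /(_ isT) /(le_trans (normr_ge0 _)).
    by rewrite pmulr_lge0// exprn_gt0.
  by rewrite ler_wpM2l// ltW.
have qC t : 0 < t <= r -> `|q.[t]| <= C * t.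
  move=> /[dup] /pC'; rewrite pq hornerM hornerXn normrM => + /andP[t0 _].
  rewrite (ger0_norm (exprn_ge0 _ (ltW t0))) exprS mulrA.
  by rewrite ler_pM2r// exprn_gt0.
have [q' [c qE]] : exists q' c, q = q' * 'X + c%:P.
  by elim/poly_ind: (q) => [|q' c _]; [exists 0, 0; rewrite mul0r addr0|exists q', c].
have [B B0 q'B] := poly_bound q'.
suff c0 : c = 0 by exists q'; rewrite pq qE c0 addr0 -mulrA -exprS.
apply/eqP; rewrite -normr_le0; apply/ler_addgt0Pl => e e0.
(* At this point the bounds on [q] ([t <= r]) and on [q'] ([t <= 1]) both apply, and
   [|c| <= (|C| + B) * t <= e]. The added 1 keeps the denominator positive. *)
pose t := Num.min (Num.min r 1) (e / (`|C| + B + 1)).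
have CB : 0 < `|C| + B + 1 by rewrite ltr_wpDl// addr_ge0.
have t0 : 0 < t by rewrite !lt_min r0 ltr01 divr_gt0.
have [tr t1 te] : [/\ t <= r, t <= 1 & t <= e / (`|C| + B + 1)].
  by rewrite !ge_min !lexx !orbT.
have -> : c = q.[t] - t * q'.[t] by rewrite qE !hornerE; ring.
rewrite addr0; apply: le_trans (ler_normB _ _) _.
have h1 : `|q.[t]| <= `|C| * t.
  by apply: le_trans (qC t _) _; rewrite ?t0 ?tr// ler_wpM2r ?ler_norm// (ltW t0).
have h2 : `|t * q'.[t]| <= B * t.
  rewrite normrM (ger0_norm (ltW t0)) mulrC ler_wpM2r ?(ltW t0)//.
  by rewrite -normcR -horner_map q'B// normcR ger0_norm// ltW.
apply: le_trans (lerD h1 h2) _; rewrite -mulrDl.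
apply: (@le_trans _ _ ((`|C| + B + 1) * t)); first by rewrite ler_wpM2r ?(ltW t0)// lerDl.
by rewrite mulrC -ler_pdivlMr.
Qed.

(* Both the truncation [p] of [f] and the truncation [E] of [exp L] agree with
   [exp K] up to [O(t^n)] at real [t], so [p - E] is divisible by ['X^n]; this
   transfers the expansion of the real function [K] to complex arguments. *)
Lemma cexp_expansion (f : R[i] -> R[i]) (K : R -> R) (a c : nat -> R) (n : nat)
    (A B : R) : (0 < n)%N -> c 0 = 0 ->
  (forall z, normc z <= 1 ->
    normc (f z - \sum_(0 <= k < n) (a k)%:C * z ^+ k) <= A * normc z ^+ n) ->
  (forall t, f t%:C = (expR (K t))%:C) ->
  (forall t, `|t| <= 1 ->
    `|K t - \sum_(0 <= k < n) c k * t ^+ k| <= B * `|t| ^+ n) ->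
  exists r C, [/\ 0 < r, 0 <= C & forall z, normc z <= r -> exists2 w,
    f z = cexp (\sum_(0 <= k < n) (c k)%:C * z ^+ k + w) &
    normc w <= C * normc z ^+ n].
Proof.
move=> n0 c0 fA fK KB.
have A0 : 0 <= A.
  have := fA 1; rewrite normc1 lexx expr1n mulr1 => /(_ isT).
  exact/le_trans/normc_ge0.
have B0 : 0 <= B.
  have := KB 1; rewrite normr1 lexx expr1n mulr1 => /(_ isT).
  exact: le_trans.
pose L := psum c n; pose p := psum a n.
(* As [c 0 = 0], the polynomial [L] is divisible by ['X]; hence [L(z)^n] is [O(z^n)] and truncating
   the exponential series of [L] at order [n] costs only [O(z^n)]. *)
have [D D0 LD] : exists2 D, 0 <= D &
    forall z, normc z <= 1 -> normc (pC L).[z] <= D * normc z.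
  have [D D0 qD] := poly_bound (psum (fun k => c k.+1) n.-1).
  exists D => // z z1.
  rewrite /L -(prednK n0) psumS c0 addr0 rmorphM/= map_polyX hornerM hornerX normcM.
  by rewrite ler_wpM2r ?normc_ge0// qD.
have LD1 z : normc z <= 1 -> normc (pC L).[z] <= D.
  by move=> z1; apply: le_trans (LD z z1) _; rewrite ler_piMr.
pose E : {poly R} := \sum_(0 <= j < n) (j`!%:R^-1) *: L ^+ j.
have EC z : (pC E).[z] = \sum_(0 <= j < n) (j`!%:R^-1)%:C * (pC L).[z] ^+ j.
  rewrite rmorph_sum horner_sum; apply: eq_bigr => j _.
  by rewrite /= map_polyZ rmorphXn hornerZ horner_exp.
pose A2 := 2 * (D ^+ n * expR D).
have EL z : normc z <= 1 ->
    normc (cexp (pC L).[z] - (pC E).[z]) <= A2 * normc z ^+ n.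
  move=> z1; rewrite EC; apply: le_trans (cexp_taylor _ _) _.
  rewrite /A2 -mulrA ler_wpM2l// mulrAC -exprMn.
  rewrite ler_pM ?exprn_ge0 ?normc_ge0 ?expR_ge0//.
    by rewrite lerXn2r ?nnegrE ?mulr_ge0 ?normc_ge0// LD.
  by rewrite ler_expR LD1.
have cexpR x : cexp x%:C = (expR x)%:C.
  by rewrite /cexp /= cos0 sin0 mulr1.
pose A3 := A + expR (B + D) * B + A2.
have pE t : 0 < t <= 1 -> `|(p - E).[t]| <= A3 * t ^+ n.
  move=> /andP[t0 t1].
  have nt : normc t%:C = t by rewrite normcR ger0_norm// ltW.
  have nt1 : normc t%:C <= 1 by rewrite nt.
  have -> : (p - E).[t] = (p.[t] - expR (K t)) + (expR (K t) - expR L.[t]) +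
     (expR L.[t] - E.[t]) by rewrite hornerD hornerN; ring.
  have h1 : `|p.[t] - expR (K t)| <= A * t ^+ n.
    by have := fA _ nt1; rewrite fK -horner_psumC horner_map -rmorphB nt normcR distrC.
  have h3 : `|expR L.[t] - E.[t]| <= A2 * t ^+ n.
    by have := EL _ nt1; rewrite !horner_map cexpR -rmorphB nt normcR.
  have h2 : `|expR (K t) - expR L.[t]| <= expR (B + D) * B * t ^+ n.
    have tn : `|t| <= 1 by rewrite ger0_norm// ltW.
    have := KB _ tn; rewrite -horner_psum -/L (ger0_norm (ltW t0)) => KL.
    apply: le_trans (expR_sub_le _ _) _; rewrite -mulrA ler_pM ?expR_ge0//.
    have tB : B * t ^+ n <= B.
      by rewrite ler_piMr// exprn_ile1// ltW.
    have LtD : `|L.[t]| <= D by have := LD1 _ nt1; rewrite horner_map normcR.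
    by rewrite ler_expR lerD// (le_trans KL).
  rewrite /A3 !mulrDl; apply: le_trans (ler_normD _ _) _.
  by apply: lerD => //; apply: le_trans (ler_normD _ _) _; apply: lerD.
have [q pEq] := poly_divXn ltr01 pE.
have [B' B'0 qB'] := poly_bound q.
pose A4 := A + B' + A2.
have A40 : 0 <= A4.
  by rewrite !addr_ge0// mulr_ge0// mulr_ge0 ?exprn_ge0 ?expR_ge0.
have fL z : normc z <= 1 -> normc (f z - cexp (pC L).[z]) <= A4 * normc z ^+ n.
  move=> z1; rewrite /A4 !mulrDl.
  have -> : f z - cexp (pC L).[z] = (f z - (pC p).[z]) + (pC (p - E)).[z] -
      (cexp (pC L).[z] - (pC E).[z]).
    by rewrite rmorphB/= hornerD hornerN; ring.
  apply: le_trans (normcB _ _) _; apply: lerD; last exact: EL.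
  apply: le_trans (le_normcD _ _) _; apply: lerD.
    by rewrite horner_psumC fA.
  rewrite pEq rmorphM/= map_polyXn hornerM hornerXn normcM normcX.
  by rewrite ler_wpM2r ?exprn_ge0 ?normc_ge0// qB'.
pose A5 := A4 * expR D.
have A50 : 0 <= A5 by rewrite mulr_ge0 ?expR_ge0.
(* Within this radius and the unit disc, [A5 * |z|^n <= (A5 + 1) * |z| <= 1/2], as [cexp_near1]
   requires. *)
have r0 : 0 < (2 * (A5 + 1))^-1.
  by rewrite invr_gt0 mulr_gt0// ltr_wpDl.
exists (Num.min 1 (2 * (A5 + 1))^-1), (4 * A5); split.
- by rewrite lt_min ltr01.
- by rewrite mulr_ge0.
move=> z; rewrite le_min => /andP[z1 zr].
have zn : normc z ^+ n <= normc z.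
  by rewrite -[leRHS]expr1; apply: ler_wiXn2l; rewrite ?normc_ge0.
(* The quotient of [f z] by [cexp (L z)] is close to 1; its logarithm is the error term [w], and the
   constant 4 of [cexp_near1] yields the bound [4 * A5]. *)
pose u := f z * cexp (- (pC L).[z]).
have u1 : normc (u - 1) <= A5 * normc z ^+ n.
  have -> : u - 1 = (f z - cexp (pC L).[z]) * cexp (- (pC L).[z]).
    by rewrite mulrBl -cexpD subrr cexp0.
  rewrite normcM mulrAC ler_pM ?normc_ge0 ?fL// normc_cexp ler_expR ReN.
  apply: le_trans (LD1 _ z1); apply: le_trans (normc_Re _).
  by rewrite -normrN ler_norm.
have u2 : normc (u - 1) <= 2^-1.
  apply: le_trans u1 _; apply: (@le_trans _ _ ((A5 + 1) * (2 * (A5 + 1))^-1)).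
    by rewrite ler_pM ?exprn_ge0 ?normc_ge0// ?lerDl// (le_trans zn).
  by rewrite invfM mulrCA divff ?mulr1// gt_eqF// ltr_wpDl.
have [w uw wC] := cexp_near1 u2.
exists w.
  rewrite -horner_psumC cexpD -uw /u mulrCA -cexpD subrr cexp0 mulr1//.
apply: le_trans wC _; by rewrite -mulrA ler_wpM2l.
Qed.

End power_series_matching.

(** * Closure properties of iterated derivability, and Taylor's formula *)

Section iterated_derivability.
Variable R : realType.
Implicit Types f g : R -> R.

(** Derivability [n] times on the whole line, with no continuity demanded of the last derivative. *)
Fixpoint smooth (n : nat) f : Prop :=
  if n is m.+1 then (forall x : R, derivable f x 1) /\ smooth m (derive1 f) else True.

Lemma smoothS n f df : (forall x : R, is_derive x 1 f (df x)) -> smooth n df ->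
  smooth n.+1 f.
Proof.
move=> fd dfn; split; first by move=> x; case: (fd x).
suff -> : derive1 f = df by [].
by apply/funext => x; rewrite derive1E; case: (fd x).
Qed.

Lemma smooth_derive1 n f (x : R) : smooth n.+1 f -> is_derive x 1 f (derive1 f x).
Proof. by move=> [fd _]; rewrite derive1E; apply/derivableP. Qed.

Lemma smoothW n f : smooth n.+1 f -> smooth n f.
Proof.
elim: n f => // n IHn f [fd fn]; split => //; exact: IHn.
Qed.

Lemma smoothD n f g : smooth n f -> smooth n g -> smooth n (fun x => f x + g x).
Proof.
elim: n f g => // n IHn f g fn gn.
apply: (@smoothS _ _ (fun x => derive1 f x + derive1 g x)).
  by move=> x; exact: (is_deriveD (smooth_derive1 x fn) (smooth_derive1 x gn)).
by apply: IHn; [case: fn|case: gn].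
Qed.

Lemma smoothM n f g : smooth n f -> smooth n g -> smooth n (fun x => f x * g x).
Proof.
elim: n f g => // n IHn f g fn gn.
apply: (@smoothS _ _ (fun x => derive1 f x * g x + f x * derive1 g x)).
  by move=> x; exact: (is_derive_mul (smooth_derive1 x fn) (smooth_derive1 x gn)).
by apply: smoothD; apply: IHn; try exact: smoothW; [case: fn|case: gn].
Qed.

Lemma smoothN n f : smooth n f -> smooth n (fun x => - f x).
Proof.
elim: n f => // n IHn f fn.
apply: (@smoothS _ _ (fun x => - derive1 f x)).
  by move=> x; exact: (is_deriveN (smooth_derive1 x fn)).
by apply: IHn; case: fn.
Qed.

Lemma smoothV n f : (forall x, f x != 0) -> smooth n f ->
  smooth n (fun x => (f x)^-1).
Proof.
move=> f0; elim: n => // n IHn fn.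
have Vn := IHn (smoothW fn).
apply: (@smoothS _ _ (fun x => - ((f x)^-1 * (f x)^-1 * derive1 f x))).
  move=> x; apply: is_derive_eq (is_deriveV (f0 x) (smooth_derive1 x fn)) _.
  by rewrite /GRing.scale/= expr2 invfM mulNr.
apply: smoothN; apply: smoothM; first exact: smoothM.
by case: fn.
Qed.

Lemma is_derive_ln f (x df : R) : 0 < f x -> is_derive x 1 f df ->
  is_derive x 1 (fun x => ln (f x)) (df / f x).
Proof.
move=> f0 fd; rewrite mulrC.
exact: (@is_derive1_comp R (@ln R) f x _ _ (is_derive1_ln f0) fd).
Qed.

Lemma smooth_ln n f : (forall x, 0 < f x) -> smooth n f ->
  smooth n (fun x => ln (f x)).
Proof.
case: n => // n f0 fn.
apply: (@smoothS _ _ (fun x => derive1 f x / f x)).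
  by move=> x; exact: (is_derive_ln (f0 x) (smooth_derive1 x fn)).
apply: smoothM; first by case: fn.
by apply: smoothV (smoothW fn) => x; rewrite gt_eqF.
Qed.

Lemma smooth_derive1n n f k (x : R) : smooth n f -> (k < n)%N ->
  is_derive x 1 (derive1n k f) (derive1n k.+1 f x).
Proof.
elim: n f k => // n IHn f [|k] fn kn; first exact: (smooth_derive1 x fn).
by have := IHn (derive1 f) k (proj2 fn) kn; rewrite -!derive1Sn.
Qed.

Lemma continuous_bounded_itv f (a b : R) : a <= b ->
  (forall x, {for x, continuous f}) ->
  exists C, forall x, a <= x <= b -> `|f x| <= C.
Proof.
move=> ab cf.
have wcf : {within `[a, b], continuous f}.
  by apply: continuous_subspaceT => x; exact: cf.
have [c1 _ h1] := EVT_max ab wcf; have [c2 _ h2] := EVT_min ab wcf.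
exists (`|f c1| + `|f c2|) => x axb.
have {}h1 := h1 x; have {}h2 := h2 x; rewrite in_itv/= axb in h1 h2.
rewrite ler_norml; apply/andP; split.
  apply: le_trans (h2 isT); rewrite lerNl -[leLHS]add0r lerD//.
  by rewrite -normrN ler_norm.
by apply: le_trans (h1 isT) _; rewrite -[leLHS]addr0 lerD// ler_norm.
Qed.

(** The extra order of derivability makes the [n]-th derivative continuous, hence bounded on
    [[-1, 1]]. *)
Lemma smooth_taylor n f : smooth n.+1 f -> exists B, forall x, `|x| <= 1 ->
  `|f x - \sum_(0 <= k < n) (derive1n k f 0 / k`!%:R) * x ^+ k| <= B * `|x| ^+ n.
Proof.
move=> fn.
have [C fC] : exists C, forall x, - 1 <= x <= 1 -> `|derive1n n f x| <= C.
  apply: continuous_bounded_itv => [|x]; first lra.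
  exact: is_derive_continuous (smooth_derive1n x fn (ltnSn n)).
exists C => x x1.
have := @taylor_bound R n (fun k => derive1n k f) 1 C _ _ x x1.
under eq_bigr do rewrite mulrAC.
apply => [k y kn|y y1]; first by apply: (smooth_derive1n y fn); rewrite ltnW.
by apply: fC; rewrite -ler_norml.
Qed.

End iterated_derivability.

(** * Integrals of finite sums *)

Section integrals.
Context d (T : measurableType d) (R : realType).
Variable mu : {measure set T -> \bar R}.

Lemma integrable_rsum (D : set T) (I : Type) (s : seq I) (f : I -> T -> R) :
  measurable D -> (forall i, mu.-integrable D (EFin \o f i)) ->
  mu.-integrable D (EFin \o (fun x => \sum_(i <- s) f i x)).
Proof.
move=> mD fi.
have -> : EFin \o (fun x => \sum_(i <- s) f i x) =
    (fun x => \sum_(i <- s) (EFin \o f i) x)%E.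
  by apply/funext => x /=; rewrite sumEFin.
by apply: integrable_sum => // i _; exact: fi.
Qed.

Lemma Rintegral_sum (D : set T) (I : Type) (s : seq I) (f : I -> T -> R) :
  measurable D -> (forall i, mu.-integrable D (EFin \o f i)) ->
  Rintegral mu D (fun x => \sum_(i <- s) f i x) =
  \sum_(i <- s) Rintegral mu D (f i).
Proof.
move=> mD fi; elim: s => [|i s IHs].
  rewrite big_nil; under eq_Rintegral do rewrite big_nil.
  by rewrite /Rintegral integral0.
under eq_Rintegral do rewrite big_cons.
by rewrite big_cons -IHs RintegralD//; exact: integrable_rsum.
Qed.

End integrals.

(** * Differentiation of the moment generating function under the expectation *)

Section mgf.
Variables (d : measure_display) (T : measurableType d) (R : realType).
Variables (P : probability T R) (zeta : {RV P >-> R}).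
Hypothesis mgf_lty : forall t : R, ('M_P zeta t < +oo)%E.

Let mzeta : measurable_fun setT (zeta : T -> R).
Proof. exact: measurable_funPT. Qed.

Lemma mgfE t : 'M_P zeta t = (\int[P]_w (expR (t * zeta w))%:E)%E.
Proof.
rewrite /mmt_gen_fun unlock; apply: eq_integral => w _ /=.
by rewrite mulrC.
Qed.

Lemma measurable_expR_scale t : measurable_fun setT (fun w => expR (t * zeta w)).
Proof.
apply: measurableT_comp => //; exact: measurable_funM.
Qed.

Lemma integrable_expR_scale t :
  P.-integrable setT (EFin \o (fun w => expR (t * zeta w))).
Proof.
apply/integrableP; split.
  by apply/measurable_EFinP; exact: measurable_expR_scale.
apply: le_lt_trans (mgf_lty t).
rewrite mgfE le_eqVlt; apply/orP; left; apply/eqP.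
by apply: eq_integral => w _ /=; rewrite ger0_norm// expR_ge0.
Qed.

(** According to the sign of [zeta], [exp(c |zeta|)] is one of [exp(c zeta)] and [exp(-c zeta)], so
    it is at most their sum. *)
Lemma integrable_expR_norm c :
  P.-integrable setT (EFin \o (fun w => expR (c * `|zeta w|))).
Proof.
apply: (@le_integrable _ _ _ _ _ measurableT _
  ((EFin \o (fun w => expR (c * zeta w))) \+
   (EFin \o (fun w => expR ((- c) * zeta w))))%E).
- apply/measurable_EFinP; apply: measurableT_comp => //.
  by apply: measurable_funM => //; exact: measurableT_comp.
- move=> w _ /=; rewrite lee_fin (ger0_norm (expR_ge0 _)) [leRHS]ger0_norm
    ?addr_ge0 ?expR_ge0//.
  have [z0|z0] := leP 0 (zeta w); first by rewrite ger0_norm// lerDl expR_ge0.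
  by rewrite ltr0_norm// mulrN mulNr lerDr expR_ge0.
- by apply: integrableD => //; exact: integrable_expR_scale.
Qed.

Lemma integrable_expR_dom (f : T -> R) (C c : R) : measurable_fun setT f ->
  (forall w, `|f w| <= C * expR (c * `|zeta w|)) ->
  P.-integrable setT (EFin \o f).
Proof.
move=> mf fC.
apply: (@le_integrable _ _ _ _ _ measurableT _
  (fun w => C%:E * (EFin \o (fun w => expR (c * `|zeta w|))) w)%E).
- exact/measurable_EFinP.
- move=> w _ /=; rewrite lee_fin; apply: le_trans (fC w) _.
  by rewrite ler_norm.
- by apply: integrableZl => //; exact: integrable_expR_norm.
Qed.

(** The [n]-th derivative of the moment generating function at [t]; at [t = 0], the [n]-th
    moment. *)
Definition mmt (n : nat) (t : R) : R :=
  Rintegral P setT (fun w => zeta w ^+ n * expR (t * zeta w)).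

Lemma measurable_mmt n t :
  measurable_fun setT (fun w => zeta w ^+ n * expR (t * zeta w)).
Proof.
apply: measurable_funM; last exact: measurable_expR_scale.
exact: measurable_funX.
Qed.

Lemma norm_mmt_le n t w :
  `|zeta w ^+ n * expR (t * zeta w)| <= n`!%:R * expR ((1 + `|t|) * `|zeta w|).
Proof.
rewrite normrM normrX mulrDl mul1r expRD mulrA ler_pM ?exprn_ge0//.
  exact: exprn_le_expR.
rewrite ger0_norm ?expR_ge0// ler_expR.
by apply: le_trans (ler_norm _) _; rewrite normrM.
Qed.

Lemma integrable_mmt n t :
  P.-integrable setT (EFin \o (fun w => zeta w ^+ n * expR (t * zeta w))).
Proof.
exact: (integrable_expR_dom (measurable_mmt n t) (norm_mmt_le n t)).
Qed.

Lemma integrable_norm_mmt n c :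
  P.-integrable setT (EFin \o (fun w => `|zeta w| ^+ n * expR (c * `|zeta w|))).
Proof.
apply: (@integrable_expR_dom _ n`!%:R (1 + c)).
  apply: measurable_funM; first by apply: measurable_funX; exact: measurableT_comp.
  apply: measurableT_comp => //; apply: measurable_funM => //.
  exact: measurableT_comp.
move=> w; rewrite ger0_norm ?mulr_ge0 ?exprn_ge0 ?expR_ge0//.
rewrite mulrDl mul1r expRD mulrA ler_wpM2r ?expR_ge0//.
exact: exprn_le_expR.
Qed.

(** The second-order Taylor remainder of [exp(h zeta)] bounds the integrand of the increment error
    by [h^2 * G], with [G] integrable and independent of [h]; [is_derive_quadratic] concludes. The 1
    in the exponent of [G] accounts for [|h| <= 1]. *)
Lemma is_derive_mmt n (t : R) : is_derive t 1 (mmt n) (mmt n.+1 t).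
Proof.
pose G w := `|zeta w| ^+ n.+2 * expR ((1 + `|t|) * `|zeta w|).
apply: (@is_derive_quadratic _ _ _ _ (Rintegral P setT G)) => h h1.
have Gi := integrable_norm_mmt n.+2 (1 + `|t|).
pose g w := zeta w ^+ n * expR ((t + h) * zeta w) - zeta w ^+ n * expR (t * zeta w)
   - h * (zeta w ^+ n.+1 * expR (t * zeta w)).
have i1 : P.-integrable setT (EFin \o
    (fun w => h * (zeta w ^+ n.+1 * expR (t * zeta w)))).
  exact: (integrableZl measurableT h (integrable_mmt n.+1 t)).
have i2 : P.-integrable setT (EFin \o (fun w =>
    zeta w ^+ n * expR ((t + h) * zeta w) - zeta w ^+ n * expR (t * zeta w))).
  exact: (integrableB measurableT (integrable_mmt n (t + h)) (integrable_mmt n t)).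
have -> : mmt n (t + h) - mmt n t - h * mmt n.+1 t = Rintegral P setT g.
  by rewrite RintegralB// RintegralB ?RintegralZl//; exact: integrable_mmt.
have gi : P.-integrable setT (EFin \o g).
  exact: (integrableB measurableT i2 i1).
apply: le_trans (le_normr_Rintegral _ gi) _ => //.
rewrite -RintegralZr//.
apply: le_Rintegral => //.
- exact: (integrable_norm gi).
- exact: (integrableZr measurableT (h ^+ 2) Gi).
move=> w _; rewrite /g /G.
have -> : zeta w ^+ n * expR ((t + h) * zeta w) - zeta w ^+ n * expR (t * zeta w)
   - h * (zeta w ^+ n.+1 * expR (t * zeta w)) =
   zeta w ^+ n * expR (t * zeta w) *
     (expR (h * zeta w) - \sum_(0 <= k < 2) (h * zeta w) ^+ k / k`!%:R).
  rewrite big_nat_recr//= big_nat1 expr0 expr1 fact0 !divr1 mulrDl expRD exprSr; ring.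
rewrite !normrM normrX.
have := expR_taylor 2 (h * zeta w).
set u := `|_ - _| => hu; have u0 : 0 <= u by exact: normr_ge0.
apply: (@le_trans _ _ (`|zeta w| ^+ n * expR (`|t| * `|zeta w|) *
   (expR `|zeta w| * (`|zeta w| ^+ 2 * h ^+ 2)))).
  rewrite ler_pM ?mulr_ge0 ?exprn_ge0//.
    rewrite ler_wpM2l ?exprn_ge0// ger0_norm ?expR_ge0// ler_expR -normrM.
    exact: ler_norm.
  apply: le_trans hu _.
  rewrite normrM exprMn real_normK ?num_real// [h ^+ 2 * _]mulrC.
  apply: ler_wpM2r; first by apply: mulr_ge0; exact: sqr_ge0.
  rewrite ler_expR.
  by rewrite ler_piMl.
rewrite mulrDl mul1r expRD !exprS expr0 mulr1 le_eqVlt; apply/orP; left; apply/eqP; ring.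
Qed.

End mgf.

(** * Cumulants and the expansion of [E[exp(zeta z)]] at complex [z] *)

Section cmgf_expansion.
Variables (d : measure_display) (T : measurableType d) (R : realType).
Variables (P : probability T R) (zeta : {RV P >-> R}).
Hypothesis mgf_lty : forall t : R, ('M_P zeta t < +oo)%E.
Hypothesis Ezeta : ('E_P[zeta] = 0)%E.
Hypothesis Ezeta2 : ('E_P[fun w => (zeta w ^+ 2)%R] = 1)%E.

Let mzeta : measurable_fun setT (zeta : T -> R).
Proof. exact: measurable_funPT. Qed.

Lemma mmt00 : mmt zeta 0 0 = 1.
Proof.
rewrite /mmt (_ : (fun _ => _) = cst 1); last first.
  by apply/funext => w; rewrite mul0r expR0 mulr1 expr0.
rewrite Rintegral_cst// mul1r.
exact: (congr1 fine (probability_setT P)).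
Qed.

Lemma mmt10 : mmt zeta 1 0 = 0.
Proof.
move: Ezeta; rewrite unlock => H.
rewrite /mmt /Rintegral (_ : (\int[P]_x _)%E = 0%E)//.
by rewrite -H; apply: eq_integral => w _; rewrite mul0r expR0 mulr1 expr1.
Qed.

Lemma mmt20 : mmt zeta 2 0 = 1.
Proof.
move: Ezeta2; rewrite unlock => H.
rewrite /mmt /Rintegral (_ : (\int[P]_x _)%E = 1%E)//.
by rewrite -H; apply: eq_integral => w _; rewrite mul0r expR0 mulr1.
Qed.

Lemma mmt0E t : fine ('M_P zeta t) = mmt zeta 0 t.
Proof.
rewrite mgfE /mmt /Rintegral; congr fine; apply: eq_integral => w _.
by rewrite expr0 mul1r.
Qed.

(** Expectation of [exp(t zeta) >= 1 + t zeta] with [zeta] centred. Positivity makes the logarithm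
    of the moment generating function derivable everywhere. *)
Lemma mmt0_ge1 t : 1 <= mmt zeta 0 t.
Proof.
have -> : 1 = Rintegral P setT
    (fun w => zeta w ^+ 0 * expR (0 * zeta w) + t * (zeta w ^+ 1 * expR (0 * zeta w))).
  rewrite RintegralD//; first last.
  - exact: (integrableZl measurableT t (integrable_mmt mgf_lty 1 0)).
  - exact: integrable_mmt.
  rewrite RintegralZl//; last exact: integrable_mmt.
  by rewrite -!/(mmt _ _ _) mmt00 mmt10 mulr0 addr0.
apply: le_Rintegral => //.
- exact: (integrableD measurableT (integrable_mmt mgf_lty 0 0)
    (integrableZl measurableT t (integrable_mmt mgf_lty 1 0))).
- exact: integrable_mmt.
by move=> w _; rewrite mul0r expR0 !expr0 !mulr1 expr1 mul1r expR_ge1Dx.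
Qed.

Lemma mmt0_gt0 t : 0 < mmt zeta 0 t.
Proof. exact: lt_le_trans (mmt0_ge1 t). Qed.

Let K t := ln (mmt zeta 0 t).

Lemma kappaE m : kappa zeta m = derive1n m K 0.
Proof. by rewrite /kappa; under eq_fun do rewrite mmt0E. Qed.

Lemma smooth_mmt n k : smooth n (mmt zeta k).
Proof.
elim: n k => // n IHn k.
by apply: (@smoothS _ _ _ (mmt zeta k.+1)) => // x; exact: is_derive_mmt.
Qed.

Lemma kappa0 : kappa zeta 0 = 0.
Proof. by rewrite kappaE /= /K mmt00 ln1. Qed.

Let K1 : derive1 K = fun x => mmt zeta 1 x / mmt zeta 0 x.
Proof.
apply/funext => x; rewrite derive1E.
by have [] := is_derive_ln (mmt0_gt0 x) (is_derive_mmt mgf_lty 0 x).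
Qed.

Lemma kappa1 : kappa zeta 1 = 0.
Proof. by rewrite kappaE derive1n1 K1 mmt10 mul0r. Qed.

Lemma kappa2 : kappa zeta 2 = 1.
Proof.
rewrite kappaE derive1nS derive1n1 K1 derive1E.
have m0 : mmt zeta 0 0 != 0 by rewrite gt_eqF// mmt0_gt0.
have [_ ->] := is_derive_mul (is_derive_mmt mgf_lty 1 0)
  (is_deriveV m0 (is_derive_mmt mgf_lty 0 0)).
by rewrite mmt00 mmt10 mmt20 invr1 mul1r mul0r addr0.
Qed.

Let measurable_ReIm_cexp z :
  measurable_fun setT (fun w => complex.Re (cexp ((zeta w)%:C * z))) /\
  measurable_fun setT (fun w => complex.Im (cexp ((zeta w)%:C * z))).
Proof.
have me : measurable_fun setT (fun w => expR (zeta w * complex.Re z)).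
  by apply: measurableT_comp => //; apply: measurable_funM.
have mi : measurable_fun setT (fun w => zeta w * complex.Im z).
  exact: measurable_funM.
split.
  under eq_fun do rewrite Re_cexp ReMr ImMr.
  apply: measurable_funM => //.
  apply: (@measurableT_comp _ _ _ _ _ _ (@cos R)) => //.
  by apply: continuous_measurable_fun; exact: continuous_cos.
under eq_fun do rewrite Im_cexp ReMr ImMr.
apply: measurable_funM => //.
apply: (@measurableT_comp _ _ _ _ _ _ (@sin R)) => //.
by apply: continuous_measurable_fun; exact: continuous_sin.
Qed.

(* Stated for [pr = Re] and [pr = Im] at once. *)
Let cmgf_taylor_proj (pr : R[i] -> R) n z :
  (forall x u, pr (x%:C * u) = x * pr u) -> (forall u v, pr (u + v) = pr u + pr v) ->
  (forall u, `|pr u| <= normc u) ->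
  measurable_fun setT (fun w => pr (cexp ((zeta w)%:C * z))) ->
  normc z <= 1 ->
  `|Rintegral P setT (fun w => pr (cexp ((zeta w)%:C * z))) -
    pr (\sum_(0 <= k < n) (mmt zeta k 0 / k`!%:R)%:C * z ^+ k)| <=
  2 * Rintegral P setT (fun w => `|zeta w| ^+ n * expR (1 * `|zeta w|)) *
    normc z ^+ n.
Proof.
move=> prZ prD prn mpr z1.
have prN u : pr (- u) = - pr u.
  have -> : - u = (- 1)%:C * u by rewrite rmorphN mulN1r.
  by rewrite prZ mulN1r.
have pr_sum (F : nat -> R[i]) : pr (\sum_(0 <= k < n) F k) =
    \sum_(0 <= k < n) pr (F k).
  have pr0 : pr 0 = 0 by rewrite -[X in pr X](mul0r 0) -[X in pr (X * _)]/(0%:C) prZ mul0r.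
  by elim/big_rec2 : _ => // k x y _ <-; rewrite prD.
have nz w : normc ((zeta w)%:C * z) <= `|zeta w|.
  by rewrite normcM normcR ler_piMr.
have icexp : P.-integrable setT (EFin \o (fun w => pr (cexp ((zeta w)%:C * z)))).
  apply: (@integrable_expR_dom _ _ _ _ _ mgf_lty _ 1 1) => // w.
  rewrite !mul1r; apply: le_trans (prn _) _; rewrite normc_cexp ler_expR.
  by apply: le_trans (ler_norm _) (le_trans (normc_Re _) _).
have im k : P.-integrable setT
    (EFin \o (fun w => pr (z ^+ k) / k`!%:R * (zeta w ^+ k * expR (0 * zeta w)))).
  exact: (integrableZl measurableT _ (integrable_mmt mgf_lty k 0)).
have isum : P.-integrable setT (EFin \o (fun w => \sum_(0 <= k < n)
    pr (z ^+ k) / k`!%:R * (zeta w ^+ k * expR (0 * zeta w)))).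
  exact: integrable_rsum.
have -> : pr (\sum_(0 <= k < n) (mmt zeta k 0 / k`!%:R)%:C * z ^+ k) =
  Rintegral P setT (fun w => \sum_(0 <= k < n)
    pr (z ^+ k) / k`!%:R * (zeta w ^+ k * expR (0 * zeta w))).
  rewrite Rintegral_sum// pr_sum; apply: eq_bigr => k _.
  rewrite RintegralZl//; last exact: integrable_mmt.
  by rewrite prZ -/(mmt _ _ _); ring.
rewrite -RintegralB//.
have idiff := integrableB measurableT icexp isum.
apply: le_trans (le_normr_Rintegral _ idiff) _ => //.
have inorm := integrable_norm_mmt mgf_lty n 1.
rewrite mulrAC -RintegralZl//.
apply: le_Rintegral => //.
- exact: (integrable_norm idiff).
- exact: (integrableZl measurableT _ inorm).
move=> w _.
have -> : pr (cexp ((zeta w)%:C * z)) -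
    \sum_(0 <= k < n) pr (z ^+ k) / k`!%:R * (zeta w ^+ k * expR (0 * zeta w)) =
  pr (cexp ((zeta w)%:C * z) -
    \sum_(0 <= k < n) (k`!%:R^-1)%:C * ((zeta w)%:C * z) ^+ k).
  rewrite prD; congr (_ + _).
  rewrite prN pr_sum; congr (- _); apply: eq_bigr => k _.
  rewrite prZ exprMn -rmorphXn prZ mul0r expR0; ring.
apply: le_trans (prn _) _; apply: le_trans (cexp_taylor _ _) _.
rewrite -mulrA ler_wpM2l// mul1r mulrA ler_pM ?exprn_ge0 ?normc_ge0 ?expR_ge0//.
  by rewrite normcM normcR exprMn mulrC.
by rewrite ler_expR.
Qed.

Lemma cmgf_taylor n : exists A, forall z, normc z <= 1 ->
  normc (cmgf zeta z - \sum_(0 <= k < n) (mmt zeta k 0 / k`!%:R)%:C * z ^+ k) <=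
  A * normc z ^+ n.
Proof.
pose A := 2 * Rintegral P setT (fun w => `|zeta w| ^+ n * expR (1 * `|zeta w|)).
exists (A + A) => z z1; have [mr mi] := measurable_ReIm_cexp z.
apply: le_trans (normc_le_ReIm _) _; rewrite mulrDl lerD//.
  rewrite ReD ReN; apply: cmgf_taylor_proj => //.
  - exact: ReMr.
  - exact: ReD.
  - exact: normc_Re.
rewrite ImD ImN; apply: cmgf_taylor_proj => //.
- exact: ImMr.
- exact: ImD.
- exact: normc_Im.
Qed.

Lemma cmgf_real t : cmgf zeta t%:C = (expR (K t))%:C.
Proof.
apply: complex_ext => /=; rewrite /K ?lnK ?posrE ?mmt0_gt0//.
  apply: eq_Rintegral => w _.
  by rewrite !mul0r !mulr0 !subr0 addr0 cos0 mulr1 expr0 mul1r mulrC.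
rewrite (_ : (fun _ => _) = cst 0) ?Rintegral_cst ?mul0r//.
by apply/funext => w; rewrite !mul0r !mulr0 !addr0 sin0 mulr0.
Qed.

(** The moments give the power series of [cmgf] on the complex unit disc, the cumulants the Taylor
    polynomial of [K] on the real line; [cexp_expansion] links the two. *)
Lemma cmgf_cexp_expansion n : (0 < n)%N ->
  exists r C, [/\ 0 < r, 0 <= C & forall z, normc z <= r -> exists2 w,
    cmgf zeta z = cexp (\sum_(0 <= k < n) (kappa zeta k / k`!%:R)%:C * z ^+ k + w) &
    normc w <= C * normc z ^+ n].
Proof.
move=> n0.
have [A fA] := cmgf_taylor n.
have [B KB] := smooth_taylor (smooth_ln mmt0_gt0 (smooth_mmt n.+1 0)).
apply: (@cexp_expansion _ (cmgf zeta) K _ _ _ A B n0 _ fA cmgf_real).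
  by rewrite kappa0 mul0r.
by move=> t t1; under eq_bigr do rewrite kappaE; exact: KB.
Qed.

End cmgf_expansion.

Lemma integrable_cst_lty d (T : measurableType d) (R : realType)
    (m : {measure set T -> \bar R}) (A : set T) (k : R) :
  measurable A -> (m A < +oo)%E -> m.-integrable A (EFin \o (fun _ => k)).
Proof.
move=> mA Ay; apply/integrableP; split; first exact: measurable_cst.
rewrite (_ : (fun x => _) = cst `|k|%:E)// integral_cst//.
by rewrite lte_mul_pinfty.
Qed.

(** * Dyadic means and the decay of Haar coefficients *)

Section haar_coefficients.
Variable R : realType.
Implicit Types (f : R -> R) (n k : nat) (x t : R).
Local Notation mu := (@lebesgue_measure R).

Definition dyadic n k : set R := `[k%:R / 2 ^+ n, k.+1%:R / 2 ^+ n[.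

Definition avg f n k : R := 2 ^+ n * Rintegral mu (dyadic n k) f.

Lemma exp2_gt0 n : 0 < 2 ^+ n :> R.
Proof. by rewrite exprn_gt0. Qed.

Lemma in_dyadic n k x : (x \in dyadic n k) = (k%:R <= 2 ^+ n * x < k.+1%:R).
Proof.
rewrite mem_setE in_itv/= ler_pdivrMr ?exp2_gt0// ltr_pdivlMr ?exp2_gt0//.
by rewrite mulrC.
Qed.

Lemma dyadicP n k x : dyadic n k x <-> k%:R <= 2 ^+ n * x < k.+1%:R.
Proof. by rewrite -in_dyadic; split => [/mem_set|/set_mem]. Qed.

Lemma measurable_dyadic n k : measurable (dyadic n k).
Proof. exact: measurable_itv. Qed.

Lemma dyadic_sub01 n k : (k < 2 ^ n)%N -> dyadic n k `<=` `[0, 1].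
Proof.
move=> kn x /dyadicP/andP[kx xk] /=; rewrite in_itv/=.
have x0 : 0 <= 2 ^+ n * x by apply: le_trans kx.
rewrite pmulr_rge0 ?exp2_gt0// in x0; rewrite x0/=.
have : 2 ^+ n * x <= 2 ^+ n * 1.
  by rewrite mulr1 (ltW (lt_le_trans xk _))// -natrX ler_nat.
by rewrite ler_pM2l ?exp2_gt0.
Qed.

Lemma dyadic_measure n k : mu (dyadic n k) = (2 ^- n)%:E.
Proof.
rewrite /dyadic lebesgue_measure_itv/= lte_fin ltr_pM2r ?invr_gt0 ?exp2_gt0//.
rewrite ltr_nat ltnSn -EFinB; congr EFin.
by rewrite -mulrBl -natr1 addrAC subrr add0r mul1r.
Qed.

Lemma double_natr k : [/\ k.*2%:R = 2 * k%:R :> R,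
  k.*2.+1%:R = 2 * k%:R + 1 :> R & k.*2.+2%:R = 2 * k%:R + 2 :> R].
Proof.
by split; rewrite -?[k.*2.+2]addn2 -?[k.*2.+1]addn1 ?natrD -muln2 natrM mulrC.
Qed.

Lemma dyadic_children n k :
  dyadic n k = dyadic n.+1 k.*2 `|` dyadic n.+1 k.*2.+1.
Proof.
have [e0 e1 e2] := double_natr k.
have hx x : 2 ^+ n.+1 * x = 2 * (2 ^+ n * x) by rewrite exprS mulrA.
apply/seteqP; split => x.
  move=> /dyadicP; rewrite -natr1 => /andP[h1 h2].
  have [hm|hm] := ltP (2 ^+ n.+1 * x) k.*2.+1%:R; [left|right];
    apply/dyadicP; apply/andP; move: hm; rewrite hx ?e0 ?e1 ?e2; split; lra.
by move=> [] /dyadicP; rewrite hx ?e0 ?e1 ?e2 => /andP[h1 h2]; apply/dyadicP;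
  apply/andP; rewrite -natr1; split; lra.
Qed.

Lemma dyadic_children_disj n k :
  [disjoint dyadic n.+1 k.*2 & dyadic n.+1 k.*2.+1].
Proof.
apply/disj_setPS => x [/dyadicP/andP[_ h1] /dyadicP/andP[h2 _]].
by have := lt_le_trans h1 h2; rewrite ltxx.
Qed.

Lemma haarE n k t : haar n k t = 2 `^ (n%:R / 2) *
  (\1_(dyadic n.+1 k.*2) t - \1_(dyadic n.+1 k.*2.+1) t).
Proof.
rewrite /haar /haar00; congr (_ * _).
rewrite !indicE !in_dyadic !mem_setE !in_itv/=.
have -> : 2 ^+ n.+1 * t = 2 * (2 ^+ n * t) by rewrite exprS mulrA.
have [-> -> ->] := double_natr k.
congr ((nat_of_bool _)%:R - (nat_of_bool _)%:R).
  by apply/idP/idP => /andP[h1 h2]; apply/andP; split; lra.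
by apply/idP/idP => /andP[h1 h2]; apply/andP; split; lra.
Qed.

Lemma integrable_L2 f : in_L2 f -> mu.-integrable `[0, 1] (EFin \o f).
Proof.
move=> fL2; have f2 := Lfun2_integrable_sqr fL2.
have mf : measurable_fun (`[(0 : R), 1] : set R) f.
  apply/(measurable_restrictT _ _).2 => //.
  by move: fL2; rewrite /in_L2 inE => /andP[+ _]; rewrite inE.
have f2' : mu.-integrable `[0, 1] (EFin \o (fun x => (f \_ `[0, 1]) x ^+ 2)).
  exact: integrableS f2.
have i1 : mu.-integrable `[0, 1] (EFin \o (fun _ : R => 1 : R)).
  apply: integrable_cst_lty => //.
  by rewrite /= lebesgue_measure_itv/= lte01 oppr0 adde0 ltry.
apply: le_integrable (integrableD _ i1 f2') => //; first exact/measurable_EFinP.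
move=> x x01 /=; rewrite patchE mem_set// lee_fin.
rewrite [leRHS]ger0_norm ?addr_ge0 ?sqr_ge0//.
(* Expanding the square gives [|f| <= f^2 + 1/4], below the integrable function [1 + f^2]. *)
by have := sqr_ge0 (`|f x| - 2^-1); rewrite sqrrB real_normK ?num_real//; lra.
Qed.

Lemma integrable_dyadic f n k : in_L2 f -> (k < 2 ^ n)%N ->
  mu.-integrable (dyadic n k) (EFin \o f).
Proof.
move=> fL2 kn; apply: integrableS (integrable_L2 fL2).
- exact: measurable_itv.
- exact: measurable_dyadic.
- exact: dyadic_sub01.
Qed.

Lemma Rintegral_indic_dyadic f n k : (k < 2 ^ n)%N ->
  Rintegral mu `[0, 1] (fun t => f t * \1_(dyadic n k) t) = Rintegral mu (dyadic n k) f.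
Proof.
move=> kn.
transitivity (Rintegral mu (`[0, 1] `&` dyadic n k) f).
  by rewrite Rintegral_mkcondr patch_indic.
by congr Rintegral; apply: setIidr; exact: dyadic_sub01.
Qed.

Lemma integrable_indic_dyadic f n k : in_L2 f ->
  mu.-integrable `[0, 1] (EFin \o (fun t => f t * \1_(dyadic n k) t)).
Proof.
move=> fL2; have fi := integrable_L2 fL2.
apply: le_integrable fi => //.
- apply/measurable_EFinP; apply: measurable_funM.
    by apply/measurable_EFinP; exact: (measurable_int mu (integrable_L2 fL2)).
  exact: measurable_indic (measurable_dyadic n k).
- move=> x _ /=; rewrite lee_fin normrM indicE.
  by case: (_ \in _); rewrite ?(normr1, mulr1)// normr0 mulr0.
Qed.

Lemma double_lt n k : (k < 2 ^ n)%N -> (k.*2.+1 < 2 ^ n.+1)%N.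
Proof. by rewrite expnS mul2n -doubleS leq_double. Qed.

Lemma inner01_haar f n k : in_L2 f -> (k < 2 ^ n)%N ->
  inner01 f (haar n k) = 2 `^ (n%:R / 2) *
    (Rintegral mu (dyadic n.+1 k.*2) f - Rintegral mu (dyadic n.+1 k.*2.+1) f).
Proof.
move=> fL2 kn; have kn1 := double_lt kn.
have fi := integrable_indic_dyadic _ _ fL2.
rewrite /inner01.
under eq_Rintegral do rewrite /= haarE mulrCA mulrBr.
rewrite RintegralZl//; last first.
  exact: (integrableB _ (fi n.+1 k.*2) (fi n.+1 k.*2.+1)).
by rewrite RintegralB// !Rintegral_indic_dyadic// ltnW.
Qed.

Lemma avg_parent f n k : in_L2 f -> (k < 2 ^ n)%N ->
  avg f n k = 2 ^+ n * (Rintegral mu (dyadic n.+1 k.*2) f +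
                        Rintegral mu (dyadic n.+1 k.*2.+1) f).
Proof.
move=> fL2 kn; rewrite /avg {1}dyadic_children Rintegral_setU//.
- exact: measurable_dyadic.
- exact: measurable_dyadic.
- by rewrite -dyadic_children; exact: integrable_dyadic.
- exact: dyadic_children_disj.
Qed.

Lemma powR_half n : (2 `^ (n%:R / 2)) ^+ 2 = 2 ^+ n :> R.
Proof.
by rewrite -powR_mulrn ?powR_ge0// -powRrM divfK// powR_mulrn.
Qed.

(** The mean of the parent is the midpoint of the means of its two children, so both children
    deviate from it equally, by half their difference, which is a rescaled Haar coefficient. The bit
    [b] selects the child. *)
Lemma avg_child_sub f n k b : in_L2 f -> (k < 2 ^ n)%N -> (b < 2)%N ->
  `|avg f n.+1 (k.*2 + b) - avg f n k| =
  2 `^ (n%:R / 2) * `|inner01 f (haar n k)|.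
Proof.
move=> fL2 kn b2; rewrite (avg_parent fL2 kn) (inner01_haar fL2 kn) /avg normrM.
rewrite (ger0_norm (powR_ge0 _ _)) mulrA -expr2 powR_half.
rewrite -[X in X * `|_|](ger0_norm (ltW (exp2_gt0 n))) -normrM exprS.
move: b2; case: b => [|[|//]] _; rewrite ?addn0 ?addn1.
  by congr `|_|; ring.
by rewrite -normrN; congr `|_|; ring.
Qed.

Lemma alpha_ge n q : (2 ^+ n) ^+ (2 * q) <= @alpha R n%:Z `^ (2 * q%:R).
Proof.
rewrite -natrM powR_mulrn ?sqrtr_ge0// !exprM lerXn2r ?nnegrE ?sqr_ge0//.
rewrite sqr_sqrtr; last by rewrite addr_ge0// exprz_ge0.
have -> : (2 * n%:Z)%R = (2 * n)%N by rewrite PoszM.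
by rewrite -exprnP mulnC exprM lerDr.
Qed.

(** Each term of the convergent series for the norm of order [q + 1] is at most the sum [S], and
    [alpha n >= 2^n]. The order beyond [q] absorbs the factor [2^(n/2)] relating dyadic increments
    to Haar coefficients. *)
Lemma haar_decay f q : in_S f -> exists2 C, 0 <= C &
  forall n k b, (k < 2 ^ n)%N -> (b < 2)%N ->
    `|avg f n.+1 (k.*2 + b) - avg f n k| <= C * (2^-1 ^+ q) ^+ n.
Proof.
move=> [fL2 /(_ q.+1%:R (ler0n _ _))]; rewrite /Snorm2.
set a0 := (X in (X%:E + _)%E); set F := (X in (_ + X)%E) => Fy.
pose u n : R := \sum_(0 <= k < 2 ^ n)
  alpha R n%:Z `^ (2 * q.+1%:R) * `|inner01 f (haar n k)| ^+ 2.
have term0 n k : 0 <= alpha R n%:Z `^ (2 * q.+1%:R) * `|inner01 f (haar n k)| ^+ 2.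
  by rewrite mulr_ge0 ?powR_ge0 ?sqr_ge0.
have u0 n : 0 <= u n by apply: sumr_ge0 => k _.
have F0 : (0 <= F)%E by apply: nneseries_ge0 => n _ _; rewrite lee_fin; exact: u0.
have Ffin : F \is a fin_num.
  rewrite ge0_fin_numE//; apply: le_lt_trans Fy.
  by rewrite leeDr// lee_fin mulr_ge0 ?powR_ge0 ?sqr_ge0.
pose S := fine F; have FS : F = S%:E by rewrite fineK.
have uS n : u n <= S.
  rewrite -lee_fin -FS.
  apply: le_trans (nneseries_lim_ge n.+1 _); last first.
    by move=> i _ _; rewrite lee_fin; exact: u0.
  rewrite big_nat_recr//= leeDr//.
  by apply: sume_ge0 => i _; rewrite lee_fin; exact: u0.
have S0 : 0 <= S by apply: le_trans (uS 0).
(* After squaring, the bound needed is [S <= (1 + S)^2]; this constant avoids a square root. *)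
exists (1 + S); first by rewrite addr_ge0.
move=> n k b kn b2; rewrite avg_child_sub//.
set c := `|_|; have c0 : 0 <= c by exact: normr_ge0.
have cS : (2 ^+ n) ^+ (2 * q.+1) * c ^+ 2 <= S.
  apply: le_trans (uS n); rewrite /u big_mkord (bigD1 (Ordinal kn))//=.
  rewrite -[leLHS]addr0 lerD//; first by rewrite ler_wpM2r ?sqr_ge0// alpha_ge.
  by apply: sumr_ge0 => i _.
rewrite -(@ler_pXn2r _ 2)// ?nnegrE ?mulr_ge0 ?powR_ge0 ?exprn_ge0 ?addr_ge0//.
rewrite !exprMn powR_half.
have p0 := exp2_gt0 n.
have h1 : (2^-1 ^+ q) ^+ n = (2 ^+ n) ^- q :> R.
  by rewrite !exprVn -!exprM mulnC.
rewrite h1 exprVn ler_pdivlMr ?exprn_gt0//.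
have h2 : 2 ^+ n * c ^+ 2 * ((2 ^+ n) ^+ q) ^+ 2 <= (2 ^+ n) ^+ (2 * q.+1) * c ^+ 2.
  rewrite mulrAC ler_wpM2r ?sqr_ge0// -exprM -exprS; apply: ler_weXn2l.
    by rewrite exprn_ege1// ler1n.
  lia.
apply: le_trans h2 (le_trans cS _).
by have := sqr_ge0 S; rewrite sqrrD; lra.
Qed.

End haar_coefficients.

(** * Almost everywhere convergence of dyadic means, with a rate *)

Section haar_convergence.
Variable R : realType.
Implicit Types (f : R -> R) (n k : nat) (x t : R).
Local Notation mu := (@lebesgue_measure R).

(** The dyadic interval of level [n] around [x], with an integer index so that it exists for every
    real [x], as Lebesgue differentiation requires. *)
Let cell x n : set R :=
  `[(Num.floor (2 ^+ n * x))%:~R / 2 ^+ n, (Num.floor (2 ^+ n * x) + 1)%:~R / 2 ^+ n[.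

Let cell_shrinking x : nicely_shrinking x (cell x).
Proof.
split; first by move=> n; exact: measurable_itv.
have r0 n : 0 < 2^-1 ^+ n :> R by rewrite exprn_gt0.
(* The cell lies in the ball of radius [2^-n] about [x], whose measure is twice that of the cell. *)
exists (2, fun n => PosNum (r0 n)); split => //=.
- apply: cvg_expr; rewrite ger0_norm//; lra.
- move=> n y; rewrite /cell/= in_itv/= ler_pdivrMr ?exp2_gt0//.
  rewrite ltr_pdivlMr ?exp2_gt0// => /andP[h1 h2].
  have /andP[h3 h4] := floor_itv (2 ^+ n * x).
  have p0 := exp2_gt0 R n.
  rewrite intrD in h2 h4.
  rewrite /ball/= exprVn -[ltRHS]mul1r ltr_pdivlMr//.
  rewrite -[X in _ * X](ger0_norm (ltW p0)) -normrM mulrBl ltr_norml.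
  by apply/andP; split; lra.
- move=> n; rewrite lebesgue_measure_ball ?(ltW (r0 n))//.
  rewrite /cell lebesgue_measure_itv/= lte_fin ltr_pM2r ?invr_gt0 ?exp2_gt0//.
  rewrite ltr_int ltzD1 lexx -EFinB -EFinM lee_fin -mulrBl intrD addrAC subrr.
  by rewrite add0r mul1r exprVn mulr_natl.
Qed.

Lemma dyadic_inj n k k' x : dyadic n k x -> dyadic n k' x -> k = k'.
Proof.
move=> /dyadicP/andP[h1 h2] /dyadicP/andP[h3 h4].
have := le_lt_trans h1 h4; have := le_lt_trans h3 h2.
by rewrite !ltr_nat; lia.
Qed.

Let cellE n k x : dyadic n k x -> cell x n = dyadic n k.
Proof.
move=> /dyadicP h; rewrite /cell.
have -> : Num.floor (2 ^+ n * x) = k%:Z.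
  by apply: floor_def; rewrite intrD -!pmulrn natr1.
by rewrite intrD -!pmulrn natr1.
Qed.

(** Lebesgue differentiation along the cells. The index sequence [K] is quantified inside the almost
    everywhere statement, so that a single null set serves. *)
Lemma avg_cvg_ae f : in_L2 f -> {ae mu, forall x, forall K : nat -> nat,
  (forall n, (K n < 2 ^ n)%N /\ dyadic n (K n) x) ->
  avg f n (K n) @[n --> \oo] --> f x}.
Proof.
move=> fL2; have fi := integrable_L2 fL2.
have lf := integrable_locally_restrict (measurable_itv _) fi.
apply: (@filterS _ _ (ae_filter_ringOfSetsType mu) _ _ _)
  (lebesgue_differentiation lf) => x fx K xK.
have := nice_lebesgue_differentiation cell_shrinking lf fx.
have [K0 xK0] := xK 0%N.
have -> : (f \_ `[0, 1]) x = f x.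
  by rewrite patchE mem_set//; exact: dyadic_sub01 xK0.
move=> /fine_cvgP[_] /=; apply: cvg_trans; apply: near_eq_cvg.
near=> n; have [Kn xKn] := xK n.
rewrite /= (cellE xKn) dyadic_measure.
have -> : (\int[mu]_(y in dyadic n (K n)) ((f \_ `[0, 1]) y)%:E)%E =
    (Rintegral mu (dyadic n (K n)) f)%:E.
  rewrite /Rintegral fineK.
    apply: eq_integral => y /set_mem yD.
    by rewrite patchE mem_set//; exact: dyadic_sub01 yD.
  apply: integrable_fin_num; first exact: measurable_dyadic.
  exact: (integrable_dyadic fL2 Kn).
by rewrite inver gt_eqF ?invr_gt0 ?exp2_gt0//= invrK.
Unshelve. all: by end_near. Qed.

Lemma geometric_cvg_dist (u : nat -> R) (l C r : R) : 0 <= C -> 0 <= r <= 2^-1 ->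
  (forall n, `|u n.+1 - u n| <= C * r ^+ n) -> u @ \oo --> l ->
  forall n, `|u n - l| <= 2 * C * r ^+ n.
Proof.
move=> C0 /andP[r0 r2] uC ul n.
have H m : `|u n - u (n + m)%N| <= 2 * C * r ^+ n.
  (* The factor [1 - r^m] makes the induction close: its increase provides
     [2 * C * r^(n+m) * (1 - r)], which is at least the new increment because [r <= 1/2]. *)
  suff : `|u n - u (n + m)%N| <= 2 * C * r ^+ n * (1 - r ^+ m).
    move=> /le_trans; apply; rewrite ler_piMr ?mulr_ge0 ?exprn_ge0//.
    by rewrite gerBl exprn_ge0.
  elim: m => [|m IHm]; first by rewrite addn0 !subrr normr0 mulr0.
  rewrite addnS; apply: le_trans (ler_distD (u (n + m)%N) _ _) _.
  apply: le_trans (lerD IHm (_ : _ <= C * r ^+ (n + m))) _.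
    by rewrite distrC.
  rewrite exprD exprS.
  have h0 : 0 <= C * r ^+ n by rewrite mulr_ge0 ?exprn_ge0.
  have h1 : 0 <= r ^+ m by rewrite exprn_ge0.
  have h2 : 0 <= (C * r ^+ n) * r ^+ m * (1 - 2 * r).
    by apply: mulr_ge0; [exact: mulr_ge0|lra].
  rewrite -subr_ge0; apply: le_trans h2 _; rewrite le_eqVlt; apply/orP; left.
  by apply/eqP; ring.
have cv : (`|u n - u m|) @[m --> \oo] --> `|u n - l|.
  by apply: cvg_norm; apply: cvgB => //; exact: cvg_cst.
rewrite -(cvg_lim _ cv)//; apply: limr_le; first by apply/cvg_ex; eexists; exact: cv.
near=> m.
have nm : (n <= m)%N by near: m; exact: nbhs_infty_ge.
by rewrite -(subnKC nm).
Unshelve. all: by end_near. Qed.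

Lemma dyadic_seq x : 0 <= x < 1 -> exists K : nat -> nat,
  forall n, (K n < 2 ^ n)%N /\ dyadic n (K n) x.
Proof.
move=> /andP[x0 x1].
have H n : exists k, (k < 2 ^ n)%N /\ dyadic n k x.
  elim: n => [|n [k [kn kx]]].
    by exists 0%N; split => //; apply/dyadicP; rewrite expr0 mul1r x0.
  move: kx; rewrite dyadic_children => -[kx|kx].
    by exists k.*2; split => //; apply: ltnW; exact: double_lt.
  by exists k.*2.+1; split => //; exact: double_lt.
by have [K KP] := choice H; exists K.
Qed.

(** The intervals around [x] at consecutive levels are parent and child, so [haar_decay] bounds the
    increments of the means geometrically. The exponent [q.+1] ensures a ratio of at most 1/2. *)
Lemma avg_dist_ae f q : in_S f -> exists2 C, 0 <= C &
  {ae mu, forall x, forall n k, (k < 2 ^ n)%N -> dyadic n k x ->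
    `|avg f n k - f x| <= C * (2^-1 ^+ q.+1) ^+ n}.
Proof.
move=> fS; have [C C0 fC] := haar_decay q.+1 fS.
exists (2 * C); first by rewrite mulr_ge0.
apply: (@filterS _ _ (ae_filter_ringOfSetsType mu) _ _ _) (avg_cvg_ae (proj1 fS)) => x fx n k kn xk.
have x01 : 0 <= x < 1.
  move/dyadicP : xk => /andP[h1 h2]; have p0 := exp2_gt0 R n.
  apply/andP; split; first by rewrite -(pmulr_rge0 _ p0) (le_trans _ h1).
  by rewrite -(ltr_pM2l p0) mulr1 (lt_le_trans h2)// -natrX ler_nat.
have [K KP] := dyadic_seq x01.
have -> : k = K n by apply: dyadic_inj xk _; case: (KP n).
apply: (@geometric_cvg_dist (fun n => avg f n (K n))) => //.
- by rewrite exprn_ge0//= exprS ler_piMr// exprn_ile1//; lra.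
- move=> m; have [Km xKm] := KP m; have [_ xKm1] := KP m.+1.
  have [b b2 ->] : exists2 b, (b < 2)%N & K m.+1 = ((K m).*2 + b)%N.
    move: (xKm); rewrite dyadic_children => -[xb|xb].
      by exists 0%N => //; rewrite addn0; exact: dyadic_inj xKm1 xb.
    by exists 1%N => //; rewrite addn1; exact: dyadic_inj xKm1 xb.
  exact: fC.
- exact: fx.
Qed.

Lemma avg_bound f : in_S f -> exists2 B, 0 <= B &
  forall n k, (k < 2 ^ n)%N -> `|avg f n k| <= B.
Proof.
move=> fS; have [C C0 fC] := haar_decay 1 fS.
pose A := `|avg f 0 0|.
exists (A + 2 * C); first by rewrite addr_ge0 ?mulr_ge0// normr_ge0.
(* Climbing from the interval to its ancestors up to level 0 sums a geometric series of ratio 1/2;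
   its exact partial sum is the inductive bound. *)
move=> n k kn; apply: (@le_trans _ _ (A + 2 * C * (1 - 2^-1 ^+ n))); last first.
  by rewrite lerD2l ler_piMr ?mulr_ge0// gerBl exprn_ge0.
elim: n k kn => [|n IHn] k kn.
  by move: kn; rewrite ltnS leqn0 => /eqP ->; rewrite expr0 subrr mulr0 addr0.
have kn2 : (k./2 < 2 ^ n)%N by move: kn; rewrite expnS; lia.
have [b b2 kE] : exists2 b, (b < 2)%N & k = ((k./2).*2 + b)%N.
  by exists (odd k); [case: (odd k)|rewrite addnC odd_double_half //].
rewrite {1}kE -[X in `|X|](subrK (avg f n k./2)).
apply: le_trans (ler_normD _ _) _.
apply: le_trans (lerD (fC _ _ _ kn2 b2) (IHn _ kn2)) _.
rewrite expr1 exprS; lra.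
Qed.

End haar_convergence.

(** * Integrals of almost everywhere bounded functions on sets of finite measure *)

Section ae_bounds.
Context d (T : measurableType d) (R : realType).
Variable m : {measure set T -> \bar R}.
Variables (D : set T) (h : T -> R) (e : R).
Hypotheses (mD : measurable D) (Dy : (m D < +oo)%E) (mh : measurable_fun D h).
Hypothesis he : {ae m, forall x, D x -> `|h x| <= e}.

Let ae_le_cst : (\int[m]_(x in D) `|h x|%:E <= \int[m]_(x in D) `|e|%:E)%E.
Proof.
apply: ae_ge0_le_integral => //.
- by apply/measurable_EFinP; exact: measurableT_comp.
- apply: (@filterS _ _ (ae_filter_ringOfSetsType m) _ _ _) he => x hx Dx.
  by rewrite lee_fin (le_trans (hx Dx))// ler_norm.
Qed.

Lemma ae_bounded_integrable : m.-integrable D (EFin \o h).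
Proof.
apply/integrableP; split; first exact/measurable_EFinP.
apply: le_lt_trans ae_le_cst _.
rewrite (integral_cst m mD `|e|%:E) lte_mul_pinfty//.
Qed.

Lemma ae_bounded_Rintegral : `|Rintegral m D h| <= `|e| * fine (m D).
Proof.
apply: le_trans (le_normr_Rintegral mD ae_bounded_integrable) _.
rewrite -Rintegral_cst//; apply: fine_le ae_le_cst.
- apply: integrable_fin_num => //; exact: (integrable_norm ae_bounded_integrable).
- apply: integrable_fin_num => //; exact: integrable_cst_lty.
Qed.

End ae_bounds.

(** * Splitting integrals over dyadic intervals, and differences of powers *)

Section dyadic_sums.
Variable R : realType.
Implicit Types (n k : nat).
Local Notation mu := (@lebesgue_measure R).

Lemma Rintegral_dyadic_split (h : R -> R) n :
  mu.-integrable `[0, 1] (EFin \o h) ->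
  Rintegral mu `[0, 1] h = \sum_(0 <= k < 2 ^ n) Rintegral mu (dyadic n k) h.
Proof.
move=> hi.
have H j : (j <= 2 ^ n)%N -> Rintegral mu `[0, j%:R / 2 ^+ n[ h =
    \sum_(0 <= k < j) Rintegral mu (dyadic n k) h.
  elim: j => [|j IHj] jn.
    by rewrite big_geq// mul0r set_itvco0 Rintegral_set0.
  have le_j : j%:R / 2 ^+ n <= j.+1%:R / 2 ^+ n :> R.
    by rewrite ler_pM2r ?invr_gt0 ?exp2_gt0// ler_nat.
  have U : `[0, j.+1%:R / 2 ^+ n[%classic = `[0, j%:R / 2 ^+ n[ `|` dyadic n j :> set R.
    by rewrite (@itv_bndbnd_setU _ _ _ (BLeft (j%:R / 2 ^+ n)))//
      bnd_simp// divr_ge0// exprn_ge0.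
  rewrite U Rintegral_setU.
  - by rewrite IHj ?big_nat_recr// ltnW.
  - exact: measurable_itv.
  - exact: measurable_dyadic.
  - rewrite -U; apply: integrableS hi; try exact: measurable_itv.
    apply: subset_itvl; rewrite bnd_simp/= ler_pdivrMr ?exp2_gt0// mul1r.
    by rewrite -natrX ler_nat.
  - apply/disj_setPS => x [/=]; rewrite /dyadic/= !in_itv/=.
    move=> /andP[_ h1] /andP[h2 _].
    by have := lt_le_trans h1 h2; rewrite ltxx.
(* The dyadic intervals cover [[0, 1[]; the endpoint 1 does not change the integral. *)
rewrite -H// natrX divff ?gt_eqF ?exp2_gt0// Rintegral_itv_bndo_bndc//.
apply: integrableS hi; try exact: measurable_itv.
by apply: subset_itvl; rewrite bnd_simp.
Qed.

(** Induction on the telescoping identity for powers; [1 <= B] allows the uniform exponent [m] in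
    place of the sharp [m - 1]. *)
Lemma normc_subX (u v : R[i]) (B : R) (m : nat) : 1 <= B ->
  normc u <= B -> normc v <= B ->
  normc (u ^+ m - v ^+ m) <= m%:R * B ^+ m * normc (u - v).
Proof.
move=> B1 uB vB; have B0 : 0 <= B by apply: le_trans B1.
elim: m => [|m IHm]; first by rewrite !expr0 subrr normc0 !mul0r.
have -> : u ^+ m.+1 - v ^+ m.+1 = u * (u ^+ m - v ^+ m) + (u - v) * v ^+ m.
  by rewrite !exprS; ring.
apply: le_trans (le_normcD _ _) _; rewrite !normcM normcX.
have h1 : normc u * normc (u ^+ m - v ^+ m) <= B * (m%:R * B ^+ m * normc (u - v)).
  by rewrite ler_pM ?normc_ge0.
have h2 : normc (u - v) * normc v ^+ m <= normc (u - v) * B ^+ m.+1.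
  rewrite ler_wpM2l ?normc_ge0// exprS -[leLHS]mul1r ler_pM ?exprn_ge0 ?normc_ge0//.
  by rewrite lerXn2r ?nnegrE ?normc_ge0.
apply: le_trans (lerD h1 h2) _.
by rewrite -natr1 exprS le_eqVlt; apply/orP; left; apply/eqP; ring.
Qed.

End dyadic_sums.

(** * The rates [lambda m] as powers of one ratio *)

Section lambda_powers.
Variable R : realType.

(** The ratio of consecutive [lambda m], and the factor by which [Q(xi, phi_{N,k})] scales per
    level. *)
Definition rho : R := 2 `^ (- 2^-1).

Lemma rho_gt0 : 0 < rho.
Proof. exact: powR_gt0. Qed.

Lemma rho_sqr : rho ^+ 2 = 2^-1.
Proof. by rewrite -powR_mulrn ?powR_ge0// -powRrM mulNr mulVf// powR_inv1. Qed.

Lemma lambdaE m : lambda R m = 2 * rho ^+ m.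
Proof.
rewrite /lambda powRD ?pnatr_eq0 ?implybT// powRr1//; congr (_ * _).
rewrite -powR_mulrn ?(ltW rho_gt0)// -powRrM; congr powR.
by rewrite mulNr mulrC.
Qed.

Lemma rho_le1 : rho <= 1.
Proof.
rewrite -(@ler_pXn2r _ 2)// ?nnegrE ?(ltW rho_gt0)//.
by rewrite rho_sqr expr1n; lra.
Qed.

Lemma rho_lt1 : rho < 1.
Proof.
rewrite lt_neqAle rho_le1 andbT; apply/eqP => r1.
by have := rho_sqr; rewrite r1 expr1n; lra.
Qed.

Lemma near_rho_le (C e : R) : 0 < e -> \forall N \near \oo, C * rho ^+ N <= e.
Proof.
move=> e0; have C0 : 0 < `|C| + 1 by rewrite ltr_wpDl.
have /cvgrPdist_le/(_ (e / (`|C| + 1)))[] : rho ^+ n @[n --> \oo] --> (0 : R).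
  by apply: cvg_expr; rewrite ger0_norm ?rho_lt1// ltW// rho_gt0.
  by rewrite divr_gt0.
move=> n0 _ H; exists n0 => // n /H /=.
rewrite sub0r normrN ger0_norm ?exprn_ge0 ?(ltW rho_gt0)//.
rewrite ler_pdivlMr// mulrC; apply: le_trans.
by rewrite ler_wpM2r ?exprn_ge0 ?(ltW rho_gt0)// (le_trans (ler_norm C))// lerDl.
Qed.

End lambda_powers.

(** * Approximation of the integrals of [xi^m] by dyadic means *)

Section test_function_powers.
Variable R : realType.
Implicit Types (n k m q : nat).
Local Notation mu := (@lebesgue_measure R).
Variable xi : R -> R[i].
Hypothesis xiS : in_SC xi.

Definition cavg n k : R[i] :=
  avg (fun t => complex.Re (xi t)) n k +i* avg (fun t => complex.Im (xi t)) n k.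

Lemma cavg_bound : exists2 B, 0 <= B &
  forall n k, (k < 2 ^ n)%N -> normc (cavg n k) <= B.
Proof.
have [B1 B10 h1] := avg_bound (proj1 xiS).
have [B2 B20 h2] := avg_bound (proj2 xiS).
exists (B1 + B2); first by rewrite addr_ge0.
by move=> n k kn; apply: le_trans (normc_le_ReIm _) _; rewrite lerD ?h1 ?h2.
Qed.

Lemma cavg_dist_ae q : exists2 C, 0 <= C &
  {ae mu, forall x, forall n k, (k < 2 ^ n)%N -> dyadic n k x ->
    normc (cavg n k - xi x) <= C * (2^-1 ^+ q.+1) ^+ n}.
Proof.
have [C1 C10 h1] := avg_dist_ae q (proj1 xiS).
have [C2 C20 h2] := avg_dist_ae q (proj2 xiS).
exists (C1 + C2); first by rewrite addr_ge0.
apply: (filterS2 (ae_filter_ringOfSetsType mu) _ h1 h2) => x H1 H2 n k kn xk.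
apply: le_trans (normc_le_ReIm _) _.
by rewrite ReD ReN ImD ImN mulrDl lerD ?H1 ?H2.
Qed.

Let measurable_xiX m :
  measurable_fun (`[(0 : R), 1]%classic : set R) (fun t => complex.Re (xi t ^+ m)) /\
  measurable_fun (`[(0 : R), 1]%classic : set R) (fun t => complex.Im (xi t ^+ m)).
Proof.
have mf f : in_S f -> measurable_fun (`[(0 : R), 1]%classic : set R) f.
  move=> fS; apply/measurable_EFinP.
  exact: (measurable_int mu (integrable_L2 (proj1 fS))).
have mr := mf _ (proj1 xiS); have mi := mf _ (proj2 xiS).
elim: m => [|m [IHr IHi]].
  by split; exact: measurable_cst.
split.
  under [X in measurable_fun _ X]eq_fun do rewrite exprS ReM.
  by apply: measurable_funB; exact: measurable_funM.
under [X in measurable_fun _ X]eq_fun do rewrite exprS ImM.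
by apply: measurable_funD; exact: measurable_funM.
Qed.

(* Stated for [pr = Re] and [pr = Im] at once. *)
Let proj_approx (pr : R[i] -> R) m n (D e : R) :
  (forall u v, pr (u - v) = pr u - pr v) -> (forall u, `|pr u| <= normc u) ->
  measurable_fun (`[(0 : R), 1]%classic : set R) (fun t => pr (xi t ^+ m)) ->
  {ae mu, forall x, (`[(0 : R), 1]%classic : set R) x -> normc (xi x ^+ m) <= D} -> 0 <= e ->
  {ae mu, forall x, forall k, (k < 2 ^ n)%N -> dyadic n k x ->
    normc (cavg n k ^+ m - xi x ^+ m) <= e} ->
  `|2 ^- n * (\sum_(0 <= k < 2 ^ n) pr (cavg n k ^+ m)) -
    Rintegral mu `[0, 1] (fun t => pr (xi t ^+ m))| <= e.
Proof.
move=> prB prn mpr hD e0 he.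
have p0 := exp2_gt0 R n.
have hi : mu.-integrable `[0, 1] (EFin \o (fun t => pr (xi t ^+ m))).
  apply: (@ae_bounded_integrable _ _ _ mu _ _ D) => //.
    by rewrite /= lebesgue_measure_itv/= lte01 oppr0 adde0 ltry.
  apply: (@filterS _ _ (ae_filter_ringOfSetsType mu) _ _ _) hD => x xD x01.
  by apply: le_trans (prn _) (xD x01).
rewrite (Rintegral_dyadic_split n hi) mulr_sumr -sumrB.
apply: le_trans (ler_norm_sum _ _ _) _.
apply: (@le_trans _ _ (\sum_(0 <= k < 2 ^ n) e * 2 ^- n)); last first.
  rewrite sumr_const_nat subn0 -[_ *+ (2 ^ n)]mulr_natr natrX -mulrA mulVf ?mulr1//.
rewrite big_nat [leRHS]big_nat; apply: ler_sum => k /= kn.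
have dy : (mu (dyadic n k) < +oo)%E by rewrite dyadic_measure ltry.
have hid : mu.-integrable (dyadic n k) (EFin \o (fun t => pr (xi t ^+ m))).
  apply: integrableS hi; [exact: measurable_itv|exact: measurable_dyadic|].
  exact: dyadic_sub01.
have -> : 2 ^- n * pr (cavg n k ^+ m) =
    Rintegral mu (dyadic n k) (fun _ => pr (cavg n k ^+ m)).
  rewrite (Rintegral_cst mu (measurable_dyadic n k)) mulrC; congr (_ * _).
  by rewrite -[RHS]/(fine (mu (dyadic n k))) dyadic_measure.
rewrite -RintegralB//; [|exact: measurable_dyadic|]; last first.
  apply: integrable_cst_lty => //; exact: measurable_dyadic.
have -> : 2 ^- n = fine (mu (dyadic n k)) by rewrite dyadic_measure.
rewrite -[X in X * fine _](ger0_norm e0).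
apply: ae_bounded_Rintegral => //.
- exact: measurable_dyadic.
- apply: measurable_funB => //.
  by apply/measurable_EFinP; exact: (measurable_int mu hid).
- apply: (@filterS _ _ (ae_filter_ringOfSetsType mu) _ _ _) he => x xk xD.
  by rewrite -prB; apply: le_trans (prn _) (xk k kn xD).
Qed.

(** The normalised sum is the integral of a step function with values [cavg^m]. It is almost
    everywhere close to [xi^m], since the means converge to [xi] at the stated rate and powers are
    Lipschitz on bounded sets. *)
Lemma SU_approx m q : exists2 C, 0 <= C & forall n,
  normc ((2 ^- n)%:C * (\sum_(0 <= k < 2 ^ n) cavg n k ^+ m) - SU m xi) <=
  C * (2^-1 ^+ q.+1) ^+ n.
Proof.
have [B B0 hB] := cavg_bound.
have [C C0 hC] := cavg_dist_ae q.
(* A common bound for the means ([B]) and for [xi] ([B + C], by comparison with the mean at level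
   0), and at least 1 as [normc_subX] requires. *)
pose B' := 1 + B + C.
have B'1 : 1 <= B' by rewrite /B'; lra.
have B'0 : 0 <= B' by apply: le_trans B'1.
have xiB : {ae mu, forall x, (`[(0 : R), 1[%classic : set R) x -> normc (xi x) <= B'}.
  apply: (@filterS _ _ (ae_filter_ringOfSetsType mu) _ _ _) hC => x xC x01.
  have x0 : dyadic 0 0 x.
    by apply/dyadicP; move: x01; rewrite /= in_itv/= expr0 mul1r.
  have := xC 0%N 0%N isT x0; rewrite expr0 mulr1 => h.
  have -> : xi x = cavg 0 0 - (cavg 0 0 - xi x) by ring.
  apply: le_trans (normcB _ _) _.
  by apply: le_trans (lerD (hB 0%N 0%N isT) h) _; rewrite /B'; lra.
(* The point 1 lies in none of the dyadic intervals considered, so the bound on [xi] extends to the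
   closed interval only up to this null set. *)
have ae1 : {ae mu, forall x : R, x <> 1}.
  exists [set 1]; split; [exact: measurable_set1|exact: lebesgue_measure_set1|].
  by move=> x /= /contrapT.
have xiD : {ae mu, forall x, (`[(0 : R), 1]%classic : set R) x -> normc (xi x ^+ m) <= B' ^+ m}.
  apply: (filterS2 (ae_filter_ringOfSetsType mu) _ xiB ae1) => x xB x1.
  rewrite /= in_itv/= => /andP[x0 xle].
  rewrite normcX lerXn2r ?nnegrE ?normc_ge0// xB//= in_itv/= x0 lt_neqAle xle andbT.
  exact/eqP.
pose e n := m%:R * B' ^+ m * (C * (2^-1 ^+ q.+1) ^+ n).
have e0 n : 0 <= e n by rewrite /e !mulr_ge0 ?exprn_ge0.
have he n : {ae mu, forall x, forall k, (k < 2 ^ n)%N -> dyadic n k x ->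
    normc (cavg n k ^+ m - xi x ^+ m) <= e n}.
  apply: (filterS2 (ae_filter_ringOfSetsType mu) _ xiB hC) => x xB xC k kn xk.
  apply: le_trans (@normc_subX _ _ _ B' m B'1 _ _) _.
  - by apply: le_trans (hB n k kn) _; rewrite /B'; lra.
  - apply: xB; have := dyadic_sub01 kn xk.
    rewrite /= !in_itv/= => /andP[-> _] /=.
    move/dyadicP : xk => /andP[_ h2]; have p0 := exp2_gt0 R n.
    by rewrite -(ltr_pM2l p0) mulr1 (lt_le_trans h2)// -natrX ler_nat.
  - by rewrite /e ler_wpM2l ?mulr_ge0 ?exprn_ge0// xC.
exists (2 * (m%:R * B' ^+ m * C)); first by rewrite !mulr_ge0 ?exprn_ge0.
move=> n; have [mr mi] := measurable_xiX m.
have -> : 2 * (m%:R * B' ^+ m * C) * (2^-1 ^+ q.+1) ^+ n = e n + e n.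
  by rewrite /e; ring.
apply: le_trans (normc_le_ReIm _) _; rewrite lerD//.
  rewrite ReD ReN ReMr Re_sum; apply: (proj_approx _ _ mr xiD (e0 n) (he n)).
    by move=> u v; rewrite ReD ReN.
  exact: normc_Re.
rewrite ImD ImN ImMr Im_sum; apply: (proj_approx _ _ mi xiD (e0 n) (he n)).
  by move=> u v; rewrite ImD ImN.
exact: normc_Im.
Qed.

Lemma Q_phi n k : (k < 2 ^ n)%N -> Q xi (@phi R n k) = (rho R ^+ n)%:C * cavg n k.
Proof.
move=> kn.
have c2 : 2 `^ (n%:R / 2) = rho R ^+ n * 2 ^+ n :> R.
  rewrite -powR_mulrn ?(ltW (rho_gt0 R))// -powRrM -[2 ^+ n]powR_mulrn// -powRD//.
    by congr powR; field.
  by rewrite pnatr_eq0 implybT.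
have H f : in_S f ->
  Rintegral mu `[0, 1] (fun t => f t * (2 `^ (n%:R / 2) * \1_(dyadic n k) t)) =
  rho R ^+ n * avg f n k.
  move=> [fL2 _]; under eq_Rintegral do rewrite mulrCA.
  rewrite RintegralZl//; last exact: integrable_indic_dyadic.
  by rewrite Rintegral_indic_dyadic// c2 /avg mulrA.
apply: complex_ext.
  rewrite ReMr -(H _ (proj1 xiS)); apply: eq_Rintegral => t _.
  by rewrite /phi ReM /= mulr0 subr0.
rewrite ImMr -(H _ (proj2 xiS)); apply: eq_Rintegral => t _.
by rewrite /phi ImM /= mulr0 add0r.
Qed.

End test_function_powers.

(** * Assembling the asymptotic expansion with an explicit error *)

Section expansion.
Variables (d : measure_display) (T : measurableType d) (R : realType).
Variables (P : probability T R) (zeta : {RV P >-> R}) (xi : R -> R[i]).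
Hypothesis mgf_lty : forall t : R, ('M_P zeta t < +oo)%E.
Hypothesis Ezeta : ('E_P[zeta] = 0)%E.
Hypothesis Ezeta2 : ('E_P[fun w => (zeta w ^+ 2)%R] = 1)%E.
Hypothesis xiS : in_SC xi.
Variable M : nat.
Hypothesis M3 : (3 <= M)%N.

Let target N : R[i] := \sum_(3 <= m < M.+1)
  (kappa zeta m / m`!%:R * lambda R m ^+ N)%:C * SU m xi.

Let A N m : R[i] := (2 ^- N)%:C * \sum_(0 <= k < 2 ^ N) cavg xi N k ^+ m.

Let rho0 : 0 <= rho R. Proof. by rewrite ltW ?rho_gt0. Qed.

Let lambda_ge0 m : 0 <= lambda R m. Proof. exact: powR_ge0. Qed.

(** Each of the [2^N] summands carries the factor [2^(-N m / 2)], and [2^N * 2^(-N m / 2)] is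
    [lambda_m^N]. *)
Lemma sum_power_Q_phi N m :
  \sum_(0 <= k < 2 ^ N) Q xi (@phi R N k) ^+ m = (lambda R m ^+ N)%:C * A N m.
Proof.
rewrite /A mulrA -rmorphM/= mulr_sumr big_nat [RHS]big_nat.
apply: eq_bigr => k /= kN; rewrite Q_phi// exprMn -rmorphXn/=; congr (_%:C * _).
rewrite lambdaE exprMn mulrAC divff ?mul1r ?gt_eqF ?exp2_gt0//.
by rewrite -!exprM mulnC.
Qed.

Lemma lambda2 : lambda R 2 = 1.
Proof. by rewrite lambdaE rho_sqr divff. Qed.

(** The product of the cumulant expansions over all intervals. The [2^N] remainders of size
    [rho^(N (M+1))] add up to [w], while the second error sum replaces the dyadic sums [A N m] by
    their limits. *)
Lemma Smu_cexp : exists r C, [/\ 0 < r, 0 <= C & forall N, C * rho R ^+ N <= r ->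
  exists2 w, Smu zeta N xi = cexp (target N + w +
      \sum_(2 <= m < M.+1) (kappa zeta m / m`!%:R * lambda R m ^+ N)%:C *
        (A N m - SU m xi)) &
    normc w <= C * (lambda R M ^+ N * rho R ^+ N)].
Proof.
have [r [C [r0 C0 H]]] := cmgf_cexp_expansion mgf_lty Ezeta (ltn0Sn M).
have [B B0 hB] := cavg_bound xiS.
(* The summand [B] places every [Q(xi, phi_{N,k})] in the disc of radius [r]; the other one bounds
   the accumulated remainder. *)
exists r, (B + C * B ^+ M.+1); split => //.
  by rewrite addr_ge0 ?mulr_ge0 ?exprn_ge0.
move=> N Nr.
have an k : (k < 2 ^ N)%N -> normc (Q xi (@phi R N k)) <= B * rho R ^+ N.
  move=> kN; rewrite Q_phi// normcM normcR ger0_norm ?exprn_ge0// mulrC.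
  by rewrite ler_wpM2r ?exprn_ge0// hB.
have Br : B * rho R ^+ N <= r.
  apply: le_trans Nr; rewrite ler_wpM2r ?exprn_ge0// lerDl.
  by rewrite mulr_ge0 ?exprn_ge0.
pose L z : R[i] := \sum_(0 <= m < M.+1) (kappa zeta m / m`!%:R)%:C * z ^+ m.
have /choice[w wP] k : exists w : R[i], (k < 2 ^ N)%N ->
    cmgf zeta (Q xi (@phi R N k)) = cexp (L (Q xi (@phi R N k)) + w) /\
    normc w <= C * (B * rho R ^+ N) ^+ M.+1.
  (* Outside the range of [k] the remainder is given the default value 0, so that [choice] yields a
     function on all of [nat]. *)
  have [kN|kN] := boolP (k < 2 ^ N)%N; last by exists 0.
  have [w wE wC] := H _ (le_trans (an k kN) Br).
  exists w => _; split => //; apply: le_trans wC _; rewrite ler_wpM2l//.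
  by rewrite lerXn2r ?nnegrE ?normc_ge0 ?mulr_ge0 ?exprn_ge0// an.
exists (\sum_(0 <= k < 2 ^ N) w k); last first.
  apply: le_trans (normc_sum _ _) _.
  apply: (@le_trans _ _ (\sum_(0 <= k < 2 ^ N) C * (B * rho R ^+ N) ^+ M.+1)).
    by rewrite big_nat [leRHS]big_nat; apply: ler_sum => k /= kN; case: (wP k kN).
  rewrite sumr_const_nat subn0 -[_ *+ (2 ^ N)]mulr_natl natrX.
  have -> : 2 ^+ N * (C * (B * rho R ^+ N) ^+ M.+1) =
      C * B ^+ M.+1 * (lambda R M ^+ N * rho R ^+ N).
    have -> : (B * rho R ^+ N) ^+ M.+1 = B ^+ M.+1 * ((rho R ^+ M) ^+ N * rho R ^+ N).
      by rewrite exprMn (exprSr (rho R ^+ N)) -!exprM mulnC.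
    by rewrite lambdaE exprMn; ring.
  rewrite ler_wpM2r ?mulr_ge0 ?exprn_ge0// lerDr//.
rewrite /Smu big_nat.
under eq_bigr => k kN do rewrite (proj1 (wP k kN)).
rewrite -big_nat -cexp_sum -cexpD; congr cexp.
rewrite big_split/= exchange_big/=.
pose g m := (kappa zeta m / m`!%:R * lambda R m ^+ N)%:C.
have -> : \sum_(0 <= m < M.+1) \sum_(0 <= k < 2 ^ N)
    (kappa zeta m / m`!%:R)%:C * Q xi (@phi R N k) ^+ m =
    \sum_(2 <= m < M.+1) g m * A N m.
  rewrite (@big_cat_nat _ _ _ 2)//=; last by rewrite ltnS (leq_trans _ M3).
  rewrite [X in X + _]big_nat_recr// big_nat1/=.
  rewrite kappa0// kappa1// !mul0r !rmorph0 ![in X in X + _]big1 ?add0r//;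
    try by move=> k _; rewrite mul0r.
  by apply: eq_bigr => m _; rewrite -mulr_sumr sum_power_Q_phi mulrA -rmorphM.
(* Unit variance and [lambda_2 = 1]: the second-order term offsets [- Q xi xi / 2], leaving
   [A N 2 - SU 2 xi] in the error sum. *)
have gE : g 2%N = 2^-1 by rewrite /g kappa2// lambda2 expr1n mulr1 mul1r fmorphV rmorph_nat.
have -> : - Q xi xi / 2 = - (g 2%N * SU 2 xi) by rewrite gE mulNr mulrC.
have S2 : \sum_(2 <= m < M.+1) g m * SU m xi = g 2%N * SU 2 xi + target N.
  by rewrite big_ltn// ltnS (leq_trans _ M3).
under [X in _ = _ + _ + X]eq_bigr do rewrite mulrBr.
rewrite sumrB S2.
by move: (\sum_(_ <= _ < _) _) (\sum_(_ <= _ < _) _) (target N) => u v t; ring.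
Qed.

(** Once the exponent of [Smu_cexp] has modulus below [pi], the principal logarithm returns it
    unchanged, and only the two error terms remain to be bounded. *)
Lemma clog_Smu_dist : exists C, \forall N \near \oo,
  normc (clog (Smu zeta N xi) - target N) <= C * rho R ^+ N * lambda R M ^+ N.
Proof.
have [r [C [r0 C0 H]]] := Smu_cexp.
(* The regularity order [q = M] gives the rate [2^(-N (M+1))], which [lamM] places below
   [lambda_M^N * rho^N]. *)
have /choice[D DP] m : exists D, 0 <= D /\ forall N, normc (A N m - SU m xi) <=
    D * (2^-1 ^+ M.+1) ^+ N.
  by have [D D0 DP] := SU_approx xiS m M; exists D.
pose c m := `|kappa zeta m / m`!%:R|.
have c0 m : 0 <= c m by exact: normr_ge0.
pose S := \sum_(2 <= m < M.+1) c m * D m.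
have lam1 m N : (2 <= m)%N -> lambda R m ^+ N <= 1.
  move=> m2; rewrite exprn_ile1// lambdaE -ler_pdivlMl// mulr1 -rho_sqr.
  by apply: ler_wiXn2l => //; exact: rho_le1.
have half_rho : 2^-1 <= rho R.
  by rewrite -rho_sqr expr2 ler_piMl// rho_le1.
have lamM N : (2^-1 ^+ M.+1) ^+ N <= lambda R M ^+ N * rho R ^+ N.
  rewrite -exprMn lerXn2r ?nnegrE ?exprn_ge0 ?mulr_ge0//.
  rewrite lambdaE -mulrA -exprSr; apply: (@le_trans _ _ (rho R ^+ M.+1)).
    by rewrite lerXn2r ?nnegrE.
  by rewrite ler_peMl ?exprn_ge0// ler1n.
have S0 : 0 <= S by apply: sumr_ge0 => m _; rewrite mulr_ge0 ?normr_ge0//; case: (DP m).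
have errS N : normc (\sum_(2 <= m < M.+1) (kappa zeta m / m`!%:R * lambda R m ^+ N)%:C *
        (A N m - SU m xi)) <= S * (lambda R M ^+ N * rho R ^+ N).
  apply: le_trans (normc_sum _ _) _; rewrite mulr_suml big_nat [leRHS]big_nat.
  apply: ler_sum => m /andP[m2 _]; have [D0 hD] := DP m.
  rewrite normcM normcR normrM -/(c m) -!mulrA ler_wpM2l ?c0//.
  rewrite ger0_norm ?exprn_ge0// -[leRHS]mul1r ler_pM ?exprn_ge0 ?normc_ge0 ?lam1//.
  by apply: le_trans (hD N) _; rewrite ler_wpM2l.
pose Tn := \sum_(3 <= m < M.+1) c m * normc (SU m xi).
have Tbound N : normc (target N) <= Tn * rho R ^+ N.
  apply: le_trans (normc_sum _ _) _; rewrite mulr_suml big_nat [leRHS]big_nat.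
  apply: ler_sum => m /andP[m3 _].
  rewrite normcM normcR normrM -/(c m) mulrAC ler_wpM2l ?mulr_ge0 ?normc_ge0 ?c0//.
  rewrite ger0_norm ?exprn_ge0// lerXn2r ?nnegrE// lambdaE.
  (* For [m >= 3], [lambda_m <= 2 * rho^3 = rho], so every term of the target decays at least like
     [rho^N]. *)
  rewrite -(subnKC m3) exprD [rho R ^+ 3]exprS rho_sqr.
  rewrite mulrA mulrCA divff// mulr1 ler_piMr// exprn_ile1// rho_le1//.
exists (C + S).
have near1 := near_rho_le C r0.
(* Eventually the target and the errors together stay below [pi / 2], hence strictly below [pi]. *)
have near2 := near_rho_le (Tn + (C + S)) (divr_gt0 (pi_gt0 R) (ltr0n R 2)).
apply: filterS2 near1 near2 => N N1 N2.
have [w -> wC] := H N N1.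
set E := \sum_(2 <= m < M.+1) _.
have Ebound : normc E <= S * (lambda R M ^+ N * rho R ^+ N) by exact: errS.
have wE : normc (w + E) <= (C + S) * rho R ^+ N * lambda R M ^+ N.
  apply: le_trans (le_normcD _ _) _; apply: le_trans (lerD wC Ebound) _.
  by rewrite le_eqVlt; apply/orP; left; apply/eqP; ring.
rewrite clog_cexp.
  by have -> : target N + w + E - target N = w + E by ring.
rewrite -addrA; apply: le_lt_trans (le_normcD _ _) _.
apply: (@le_lt_trans _ _ (pi / 2)); last first.
  by have := pi_gt0 R; lra.
apply: le_trans N2; rewrite mulrDl lerD//.
apply: le_trans wE _; rewrite ler_piMr ?mulr_ge0 ?addr_ge0 ?exprn_ge0//.
by apply: lam1; apply: leq_trans M3.
Qed.

End expansion.

(** * From the explicit error bound to the little-o form *)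

Theorem theorem8p5 (d : measure_display) (T : measurableType d) (R : realType)
    (P : probability T R) (zeta : {RV P >-> R}) (sigma : R) (xi : R -> R[i])
    (Ezeta : ('E_P[zeta] = 0)%E)
    (Ezeta2 : ('E_P[fun w => (zeta w ^+ 2)%R] = 1)%E)
    (sigma_gt0 : 0 < sigma)
    (zeta_subgaussian : forall t : R,
       ('M_P zeta t <= (expR (sigma ^+ 2 * t ^+ 2 / 2))%:E)%E)
    (xiS : in_SC xi) (M : nat) (M_ge3 : (3 <= M)%N) :
  (fun N => clog (Smu zeta N xi) : R[i]^o) =
    (fun N => \sum_(3 <= m < M.+1)
       (kappa zeta m / m`!%:R * lambda R m ^+ N)%:C * SU m xi : R[i]^o)
    +o_\oo (fun N => (lambda R M ^+ N)%:C : R[i]^o).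
Proof.
have mgf_lty t : ('M_P zeta t < +oo)%E.
  by apply: le_lt_trans (zeta_subgaussian t) _; rewrite ltry.
have [C HC] := clog_Smu_dist mgf_lty Ezeta Ezeta2 xiS M_ge3.
(* The tolerance is a complex number; positivity means zero imaginary part and positive real part,
   which reduces the comparison to real numbers. *)
apply/eqaddoP => eps; rewrite ltcE /= => /andP[/eqP im_eps re_eps].
have -> : eps = (complex.Re eps)%:C by case: eps im_eps {re_eps} => a b /= ->.
apply: filterS2 HC (near_rho_le C re_eps) => N N1 N2.
rewrite !norm_normc -rmorphM lecR normcR ger0_norm ?exprn_ge0 ?powR_ge0//.
apply: le_trans N1 _.
by rewrite ler_wpM2r// exprn_ge0 ?powR_ge0.
Qed.
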